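(* Let $M=(\mathcal{S},\mathcal{A},H,P,r,\mu)$ be a finite-horizon MDP with $\mathcal{S}\times\mathcal{A}$ compact, and assume that for each $h\in[H]$ and $f\in C(\mathcal{S})$ the map $(s,a)\mapsto\int_{\mathcal{S}}f(s')\,dP(s'\mid h,s,a)$ is continuous. Let $k$ be a continuous positive definite kernel on $\mathcal{S}\times\mathcal{A}$ with RKHS $\mathcal{H}_k$, and let $\rho$ be a Borel probability measure on $\mathcal{S}\times\mathcal{A}$ with full support. Let $(\lambda_i)_{i\ge1}$ be the positive eigenvalues (nonincreasing, with multiplicity) of the integral operator $(\mathcal{K}_\rho g)(x)=\int k(x,x')g(x')\,d\rho(x')$ on $L^2(\rho)$, assumed infinitely many, and $(\psi_i)_{i\ge1}$ corresponding eigenfunctions, orthonormal in $L^2(\rho)$. Then the following are equivalent. (1) For every $h\in[H]$: $r(h,\cdot)\in\mathcal{H}_k$, and there exist finite signed Borel measures $(\mu_h^i)_{i\ge1}$ on $\mathcal{S}$ and a constant $C>0$ such that for every $f\in C(\mathcal{S})$, $$\int_{\mathcal{S}}f(s')\,dP(s'\mid h,s,a)=\sum_{i=1}^{\infty}\Big(\int_{\mathcal{S}}f\,d\mu_h^i\Big)\psi_i(s,a),$$ with the series converging in $L^2(\rho)$ (the equality holding $\rho$-a.e. in $(s,a)$), and $$\sum_{i=1}^\infty\frac{1}{\lambda_i}\Big|\int_{\mathcal{S}}f\,d\mu_h^i\Big|^2\le C\|f\|_{C(\mathcal{S})}^2.$$ (2) There is a constant $C'>0$ such that for every $h\in[H]$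 and $f\in C(\mathcal{S})$, the function $(\mathcal{T}_hf)(s,a)=r(h,s,a)+\mathbb{E}_{s'\sim P(\cdot\mid h,s,a)}[f(s')]$ belongs to $\mathcal{H}_k$ and $\|\mathcal{T}_hf\|_{\mathcal{H}_k}\le C'(\|f\|_{C(\mathcal{S})}+1)$.
   Context: A finite-horizon MDP $M=(\mathcal{S},\mathcal{A},H,P,r,\mu)$: state space $\mathcal{S}$, action space $\mathcal{A}$ (subsets of Euclidean spaces), horizon $H$, Borel transition probabilities $P(\cdot\mid h,s,a)$ on $\mathcal{S}$, continuous deterministic reward $r:[H]\times\mathcal{S}\times\mathcal{A}\to[0,1]$, initial distribution $\mu$. $C(\mathcal{S})$ is the space of bounded continuous functions on $\mathcal{S}$ with sup norm. A continuous positive definite kernel $k$ is symmetric with $\sum_{i,j}a_ia_jk(x_i,x_j)\ge0$ for all finite choices; $\mathcal{H}_k$ is its reproducing kernel Hilbert space with norm $\|\cdot\|_{\mathcal{H}_k}$. *)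

(* Defs.v *)
From HB Require Import structures.
From mathcomp Require Import all_boot all_order all_algebra.
From mathcomp Require Import all_classical all_reals all_analysis.
Import numFieldNormedType.Exports.
Import Order.TTheory GRing.Theory Num.Theory.

Set Implicit Arguments.
Unset Strict Implicit.
Unset Printing Implicit Defensive.

Local Open Scope classical_set_scope.
Local Open Scope ring_scope.

(* Products 'rV_n * 'rV_m then carry the product (= Borel) sigma-algebra *)
(* and the product topology.                                            *)
Section EuclidBorel.
Variables (R : realType) (n : nat).

Definition euclid_borel : set (set 'rV[R]_n) :=
  <<s (@open [the topologicalType of 'rV[R]_n]) >>.

Lemma euclid_borel0 : euclid_borel set0.
Proof. exact: sigma_algebra0. Qed.

Lemma euclid_borelC A : euclid_borel A -> euclid_borel (~` A).
Proof. by move=> h; rewrite -setTD; apply: sigma_algebraCD. Qed.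

Lemma euclid_borelU (F : (set 'rV[R]_n)^nat) :
  (forall i, euclid_borel (F i)) -> euclid_borel (\bigcup_i F i).
Proof. exact: sigma_algebra_bigcup. Qed.

HB.instance Definition _ := @isMeasurable.Build default_measure_display
  'rV[R]_n euclid_borel euclid_borel0 euclid_borelC euclid_borelU.

End EuclidBorel.

Section CS.
Variables (R : realType) (T : topologicalType).

Definition bcont (S : set T) (f : T -> R) : Prop :=
  {within S, continuous f} /\ exists M : R, forall x, S x -> `|f x| <= M.

Definition supnorm (S : set T) (f : T -> R) : R :=
  sup [set `|f x| | x in S].
End CS.

(* A kernel on D is k : X -> X -> R, only its values on D x D matter.   *)
Section RKHS.
Variables (R : realType) (X : Type).
Implicit Types (D : set X) (k : X -> X -> R).

Definition pos_def_kernel D k : Prop :=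
  (forall x y, D x -> D y -> k x y = k y x) /\
  forall (m : nat) (a : 'I_m -> R) (x : 'I_m -> X), (forall i, D (x i)) ->
    0 <= \sum_(i < m) \sum_(j < m) a i * a j * k (x i) (x j).

(* Elements of the pre-Hilbert space H_0 = span{k(x, .) : x in D}, given
   as finite lists of (coefficient, centre) pairs. *)
Definition comb_pts D (c : seq (R * X)) : Prop :=
  foldr (fun p P => D p.2 /\ P) True c.

Definition comb_eval k (c : seq (R * X)) (x : X) : R :=
  \sum_(p <- c) p.1 * k p.2 x.

Definition comb_norm2 k (c : seq (R * X)) : R :=
  \sum_(p <- c) \sum_(q <- c) p.1 * q.1 * k p.2 q.2.

Definition comb_sub (c1 c2 : seq (R * X)) : seq (R * X) :=
  c1 ++ [seq (- p.1, p.2) | p <- c2].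

(* f : X -> R (considered on D) belongs to H_k and ||f||_{H_k} <= c:
   f is the pointwise limit on D of an H_0-Cauchy sequence (u_n) with
   lim ||u_n||_{H_0} <= c  (Aronszajn: H_k is the set of such limits and
   ||f||_{H_k} = lim ||u_n||_{H_0}, independently of the sequence). *)
Definition rkhs_le D k (f : X -> R) (c : R) : Prop :=
  exists u : nat -> seq (R * X),
    (forall n, comb_pts D (u n)) /\
    (forall e : R, 0 < e -> exists N : nat, forall m n : nat,
        (N <= m)%N -> (N <= n)%N -> comb_norm2 k (comb_sub (u m) (u n)) <= e) /\
    (forall x, D x -> (fun n => comb_eval k (u n) x) @ \oo --> f x) /\
    exists l : R, (fun n => Num.sqrt (comb_norm2 k (u n))) @ \oo --> l /\ l <= c.

Definition in_rkhs D k (f : X -> R) : Prop := exists c : R, rkhs_le D k f c.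

End RKHS.

Section L2.
Context {d : measure_display} {X : measurableType d} {R : realType}.
Variables (rho : {measure set X -> \bar R}) (D : set X).

Definition L2fun (g : X -> R) : Prop :=
  measurable_fun D g /\ rho.-integrable D (fun x => ((g x) ^+ 2)%:E).

Definition L2inner (g1 g2 : X -> R) : R :=
  \int[rho]_(x in D) (g1 x * g2 x).

Definition L2dist2 (g1 g2 : X -> R) : R :=
  \int[rho]_(x in D) ((g1 x - g2 x) ^+ 2).

Definition intop (k : X -> X -> R) (g : X -> R) (x : X) : R :=
  \int[rho]_(y in D) (k x y * g y).

End L2.

(* Main.v *)
(** A function [g] lies in the RKHS with norm at most [B] iff
    [(\sum_p a_p g(x_p))^2 <= B^2 \sum_pq a_p a_q k(x_p, x_q)] for all finite
    combinations; the converse direction is the Riesz representation, obtained from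
    a minimising sequence.  On a compact domain, Riemann sums over fine partitions turn
    this into [<phi, g>^2 <= B^2 <phi, K phi>] for every [phi] in [L2(rho)], and full
    support lets one go back by replacing point masses by averages over small
    neighbourhoods (the same Riemann sums give symmetry and positivity of [K], so
    Fubini is not needed).  The [L2] inequality is compared with the expansion in the
    [psi i]: if [g = \sum_i c_i psi_i] with [\sum_i c_i^2 / lambda_i <= B^2], it is
    Cauchy-Schwarz; conversely, [phi = \sum_(i < n) (c_i / lambda_i) psi_i] gives
    [\sum_i c_i^2 / lambda_i <= B^2], and [phi] the [n]-th remainder of [g] gives
    [||phi||^2 <= B^2 lambda_n -> 0], because the Rayleigh quotient of [K] on the
    complement of the first [n] eigenfunctions is at most [lambda_n].  Finally, the
    Feller property makes [x |-> P(x)(B)] measurable for every Borel [B], which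
    provides the signed measures [B |-> \int psi_i(x) P(x)(B) drho(x)]. *)

Require Import Defs.
From HB Require Import structures.
From mathcomp Require Import all_boot all_order all_algebra.
From mathcomp Require Import all_classical all_reals all_analysis.
From mathcomp Require Import measurable_realfun ring lra.
Import numFieldNormedType.Exports.
Import Order.TTheory GRing.Theory Num.Theory.
Local Open Scope classical_set_scope.
Local Open Scope ring_scope.

Set Implicit Arguments.
Unset Strict Implicit.
Unset Printing Implicit Defensive.

(** * Finite combinations and the dual description of the RKHS norm *)

Section Combinations.
Context {R : realType} {X : Type}.
Variables (D : set X) (k : X -> X -> R).
Implicit Types (u v w : seq (R * X)) (f : X -> R).

(** Membership in [H_k] is a pointwise notion, while an expansion in the [psi i] determines a
    function only up to null sets. The two can be compared because the functions in question,
    [(s, a) |-> \int f dP], are continuous by the Feller hypothesis. Topology enters the analysis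
    only through finite tagged partitions that are fine for the kernel, so the operator theory lives
    on a measurable space. The spectral hypothesis says only that eigenfunctions expand in the
    [psi i]. To bound [K] on a complement, an eigenfunction must first be produced by attaining a
    supremum, and this is where compactness of [K] is used. From (2) to (1), the bound
    [C' (||f|| + 1)] is affine in [f] but (1) is homogeneous: subtracting the case [f = 0] and
    rescaling [f] to norm one removes the additive term at the price of a factor 3. The measures in
    (1) must be fixed before [f], so they are built directly from [P] and [psi i]. *)

Definition comb_scale (t : R) v : seq (R * X) := [seq (t * p.1, p.2) | p <- v].

Definition comb_inner u v : R :=
  \sum_(p <- u) \sum_(q <- v) p.1 * q.1 * k p.2 q.2.

Definition comb_apply f v : R := \sum_(p <- v) p.1 * f p.2.

Lemma comb_pts_cat u v : comb_pts D u -> comb_pts D v -> comb_pts D (u ++ v).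
Proof. by elim: u => //= p u IH [Dp Du] Dv; split => //; exact: IH. Qed.

Lemma comb_pts_map u (F : R -> R) :
  comb_pts D u -> comb_pts D [seq (F p.1, p.2) | p <- u].
Proof. by elim: u => //= p u IH [Dp Du]; split => //; exact: IH. Qed.

Lemma eq_big_comb u (F G : R * X -> R) : comb_pts D u ->
  (forall p, D p.2 -> F p = G p) -> \sum_(p <- u) F p = \sum_(p <- u) G p.
Proof.
move=> + FG; elim: u => [|p u IH] /= => [_|[Dp Du]]; first by rewrite !big_nil.
by rewrite !big_cons FG// IH.
Qed.

Lemma comb_norm2E u : comb_norm2 k u = comb_inner u u.
Proof. by []. Qed.

Lemma comb_inner_catl u v w :
  comb_inner (u ++ v) w = comb_inner u w + comb_inner v w.
Proof. by rewrite /comb_inner big_cat. Qed.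

Lemma comb_inner_catr u v w :
  comb_inner w (u ++ v) = comb_inner w u + comb_inner w v.
Proof.
by rewrite /comb_inner -big_split; apply: eq_bigr => p _; rewrite big_cat.
Qed.

Lemma comb_inner_scalel t u v : comb_inner (comb_scale t u) v = t * comb_inner u v.
Proof.
rewrite /comb_inner /comb_scale big_map mulr_sumr; apply: eq_bigr => p _ /=.
by rewrite mulr_sumr; apply: eq_bigr => q _; rewrite !mulrA.
Qed.

Lemma comb_inner_scaler t u v : comb_inner u (comb_scale t v) = t * comb_inner u v.
Proof.
rewrite /comb_inner mulr_sumr; apply: eq_bigr => p _ /=.
rewrite /comb_scale big_map mulr_sumr; apply: eq_bigr => q _ /=.
by rewrite !mulrA (mulrC t).
Qed.

Lemma comb_apply_cat f u v : comb_apply f (u ++ v) = comb_apply f u + comb_apply f v.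
Proof. by rewrite /comb_apply big_cat. Qed.

Lemma comb_apply_scale f t v : comb_apply f (comb_scale t v) = t * comb_apply f v.
Proof.
by rewrite /comb_apply big_map mulr_sumr; apply: eq_bigr => p _; rewrite /= mulrA.
Qed.

Lemma comb_subE u v : comb_sub u v = u ++ comb_scale (-1) v.
Proof.
by rewrite /comb_sub /comb_scale; congr cat; apply: eq_map => p; rewrite mulN1r.
Qed.

Lemma comb_apply_eval u v : comb_apply (comb_eval k u) v = comb_inner u v.
Proof.
rewrite /comb_apply /comb_eval /comb_inner exchange_big; apply: eq_bigr => p _.
by rewrite mulr_sumr; apply: eq_bigr => q _; rewrite mulrA (mulrC p.1).
Qed.

(** For [f] in the RKHS, [comb_apply f v] is the inner product of [f] with the element represented
    by [v]; this is boundedness of that functional by [c]. Squares keep square roots and the sign of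
    [c] out. *)
Definition dominated f (c : R) : Prop :=
  forall v, comb_pts D v -> comb_apply f v ^+ 2 <= c ^+ 2 * comb_norm2 k v.

End Combinations.

Lemma discriminant_le (R : realFieldType) (a b c : R) : 0 <= c ->
  (forall t, 0 <= a + 2 * t * b + t ^+ 2 * c) -> b ^+ 2 <= a * c.
Proof.
rewrite le_eqVlt => /orP[/eqP<- h|c0 h].
  have [->|b0] := eqVneq b 0; first by rewrite expr0n mulr0.
  (* With [c = 0] the quadratic is affine in [t]; this [t] would give it the value -1. *)
  have := h (- (a + 1) / (2 * b)).
  have -> : a + 2 * (- (a + 1) / (2 * b)) * b + (- (a + 1) / (2 * b)) ^+ 2 * 0 = -1.
    by field.
  by rewrite oppr_ge0 ler10.
have := h (- b / c).
have -> : a + 2 * (- b / c) * b + (- b / c) ^+ 2 * c = (a * c - b ^+ 2) / c.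
  by field; rewrite gt_eqF.
by rewrite pmulr_lge0 ?invr_gt0// subr_ge0.
Qed.

Section Duality.
Context {R : realType} {X : Type}.
Variables (D : set X) (k : X -> X -> R).
Hypothesis kpd : pos_def_kernel D k.
Implicit Types (u v w : seq (R * X)) (f : X -> R).

Local Notation "<< u , v >>" := (comb_inner k u v).

Lemma comb_innerC u v : comb_pts D u -> comb_pts D v -> << u, v >> = << v, u >>.
Proof.
move=> Du Dv; rewrite /comb_inner exchange_big/=.
apply: (@eq_big_comb _ _ D) => // q Dq; apply: (@eq_big_comb _ _ D) => // p Dp.
by rewrite kpd.1// (mulrC p.1).
Qed.

Lemma comb_norm2_ge0 u : comb_pts D u -> 0 <= comb_norm2 k u.
Proof.
move=> Du; rewrite /comb_norm2 big_tnth.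
under eq_bigr do rewrite big_tnth.
apply: (kpd.2 _ (fun i => (tnth (in_tuple u) i).1)) => i.
case: u Du i => [|p0 u Du i]; first by move=> _ [].
rewrite (tnth_nth p0) /=; case: i => i /=.
elim: u p0 Du i => [|p1 u IH] p0 /= => [[? _] [|]//|[? Du] [|i] //= iu].
by have := IH p1 Du i iu; rewrite (set_nth_default p1).
Qed.

Lemma comb_CauchySchwarz u v : comb_pts D u -> comb_pts D v ->
  << u, v >> ^+ 2 <= comb_norm2 k u * comb_norm2 k v.
Proof.
move=> Du Dv; apply: discriminant_le; first exact: comb_norm2_ge0.
move=> t; have := @comb_norm2_ge0 (u ++ comb_scale t v) (comb_pts_cat Du (comb_pts_map _ Dv)).
rewrite !comb_norm2E comb_inner_catl !comb_inner_catr.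
rewrite !comb_inner_scalel !comb_inner_scaler (comb_innerC Dv Du).
by congr (0 <= _); ring.
Qed.

Lemma cvg_comb_apply (F : nat -> X -> R) f v : comb_pts D v ->
  (forall x, D x -> F n x @[n --> \oo] --> f x) ->
  comb_apply (F n) v @[n --> \oo] --> comb_apply f v.
Proof.
move=> + Ff; rewrite /comb_apply; elim: v => [_|p v IH [Dp Dv]].
  rewrite big_nil; under eq_fun do rewrite big_nil; exact: cvg_cst.
rewrite big_cons; under eq_fun do rewrite big_cons.
by apply: cvgD; [apply: cvgMr; exact: Ff|exact: IH].
Qed.

(** Pairing [u n] with [v] is [comb_apply] of its evaluation, so Cauchy-Schwarz gives the bound for
    each [u n]. Pointwise convergence at the finitely many centres of [v] carries it to the
    limit. *)
Lemma rkhs_le_dominated f c : rkhs_le D k f c -> 0 <= c /\ dominated D k f c.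
Proof.
move=> [u [Du [_ [uf [l [ul lc]]]]]].
have l0 : 0 <= l by apply: (cvgr_to_ge ul); apply: nearW => n; exact: sqrtr_ge0.
split; first exact: le_trans lc.
move=> v Dv; apply: (@le_trans _ _ (l ^+ 2 * comb_norm2 k v)); last first.
  by rewrite ler_wpM2r ?comb_norm2_ge0// ler_pXn2r ?nnegrE// (le_trans l0).
apply: (@ler_cvg_to _ \oo _ _ (fun n => comb_apply (comb_eval k (u n)) v ^+ 2)
  (fun n => Num.sqrt (comb_norm2 k (u n)) ^+ 2 * comb_norm2 k v)).
- by rewrite expr2; under eq_fun do rewrite expr2; apply: cvgM; exact: cvg_comb_apply.
- by apply: cvgMl; rewrite expr2; under eq_fun do rewrite expr2; exact: cvgM.
- apply: nearW => n; rewrite comb_apply_eval sqr_sqrtr ?comb_norm2_ge0//.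
  exact: comb_CauchySchwarz.
Qed.

(* The minimising sequence of the functional [v |-> ||v||^2 - 2 L(v)], where
   [L(v) = \sum a_p f(x_p)], converges to the Riesz representative of [L]. *)
Lemma dominated_rkhs_le f c : 0 <= c -> dominated D k f c -> rkhs_le D k f c.
Proof.
move=> c0 fc.
pose N v := comb_norm2 k v; pose L v := comb_apply f v.
pose J v := N v - 2 * L v.
have N0 v : comb_pts D v -> 0 <= N v by exact: comb_norm2_ge0.
have LN v : comb_pts D v -> L v ^+ 2 <= c ^+ 2 * N v by exact: fc.
(* This is [2 L <= 2 c sqrt N <= c^2 + N], written without the root. *)
have Jc v : comb_pts D v -> - c ^+ 2 <= J v.
  move=> Dv; have := N0 _ Dv; have := LN _ Dv; rewrite /J.
  move: (N v) (L v) => a b h a0; rewrite leNgt; apply/negP => h2.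
  have : 0 <= (a - c ^+ 2) ^+ 2 by exact: sqr_ge0.
  nra.
pose JD := [set J v | v in comb_pts D].
have J0 : JD 0.
  by exists [::] => //; rewrite /J /N /L /comb_norm2 /comb_apply !big_nil mulr0 subr0.
have hJ : has_inf JD.
  by split; [exists 0|exists (- c ^+ 2) => _ [v Dv <-]; exact: Jc].
set j := inf JD.
have jJ v : comb_pts D v -> j <= J v.
  by move=> Dv; apply: ge_inf; [exact: hJ.2|exists v].
have j0 : j <= 0 by apply: ge_inf => //; exact: hJ.2.
have jc : - c ^+ 2 <= j by apply: lb_le_inf; [exists 0|move=> _ [v Dv <-]; exact: Jc].
pose e n : R := n.+1%:R^-1.
have e0 n : 0 < e n by rewrite invr_gt0.
have e1 n : e n <= 1 by rewrite invf_le1// ler1n.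
have ecvg : e n @[n --> \oo] --> 0 by exact: cvg_harmonic.
have /choice[v vP] n : exists v, comb_pts D v /\ J v <= j + e n.
  by have [_ [v Dv <-] /ltW Jv] := inf_adherent (e0 n) hJ; exists v.
have Dv n : comb_pts D (v n) by case: (vP n).
have Jv n : J (v n) <= j + e n by case: (vP n).
(* [v n] is within [e n] of the infimum, so [J (v n + t w) - J (v n) + e n] is a nonnegative
   quadratic in [t]. Its discriminant says that [v n] represents [L] up to an error of order
   [sqrt (e n)]. *)
have key n w : comb_pts D w -> (<< v n, w >> - L w) ^+ 2 <= e n * N w.
  move=> Dw; apply: discriminant_le; first exact: N0.
  move=> t; have := jJ (v n ++ comb_scale t w) (comb_pts_cat (Dv n) (comb_pts_map _ Dw)).
  move: (Jv n); rewrite /J /N /L !comb_norm2E comb_inner_catl !comb_inner_catr.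
  rewrite !comb_inner_scalel !comb_inner_scaler (comb_innerC Dw (Dv n)).
  rewrite comb_apply_cat comb_apply_scale.
  move: (comb_inner _ _ _) (comb_inner _ _ _) (comb_inner _ _ _) (comb_apply _ _)
    (comb_apply _ _) => x1 x2 x3 x4 x5 h1 h2; nra.
have Nb n : N (v n) <= 4 * c ^+ 2 + 2.
  move: (N0 _ (Dv n)) (LN _ (Dv n)) (Jv n) (e1 n); rewrite /J.
  move: (N (v n)) (L (v n)) (e n) => a b en a0 h1 h2 h3.
  have ? : a <= 2 * b + 1 by lra.
  rewrite leNgt; apply/negP => h4.
  have ? : 0 <= (4 * c ^+ 2 - a) ^+ 2 by exact: sqr_ge0.
  nra.
exists v; split=> //; split; [|split].
- move=> eps eps0; near \oo => M.
  exists M => m n Mm Mn; rewrite comb_subE.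
  set w := _ ++ _.
  have Dw : comb_pts D w by apply: comb_pts_cat => //; exact: comb_pts_map.
  (* The difference [w] of two terms is tested against itself: [N w] becomes a difference of two
     quantities controlled by [key], whence [(N w)^2 <= 2 (e m + e n) N w]. *)
  have Nw : N w = (<< v m, w >> - L w) - (<< v n, w >> - L w).
    by rewrite /N !comb_norm2E {1}/w comb_inner_catl comb_inner_scalel; ring.
  have Nle : N w <= 2 * (e m + e n).
    move: (key m w Dw) (key n w Dw) (N0 _ Dw) Nw (e0 m) (e0 n).
    move: (_ - L w) (_ - L w) (N w) (e m) (e n) => a b z em en h1 h2 z0 zab em0 en0.
    rewrite leNgt; apply/negP => h.
    have ? : 0 <= (a + b) ^+ 2 by exact: sqr_ge0.
    have : z ^+ 2 <= 2 * (em + en) * z by rewrite {1}zab; nra.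
    nra.
  apply: (le_trans Nle).
  have eM i : (M <= i)%N -> e i <= e M by move=> Mi; rewrite /e lef_pV2 ?posrE// ler_nat.
  apply: (@le_trans _ _ (4 * e M)); first by move: (eM _ Mm) (eM _ Mn); lra.
  have : e M <= eps / 4.
    near: M; move/cvgrPdist_le : ecvg => /(_ (eps / 4)).
    have h4 : 0 < eps / 4 by rewrite divr_gt0.
    move=> /(_ h4); apply: filterS => n; rewrite sub0r normrN; exact: le_trans (ler_norm _).
  by lra.
- move=> x Dx; apply/cvgrPdist_le => eps eps0.
  have N1 : 0 < 1 + N [:: (1, x)] by rewrite ltr_pwDl// N0.
  have h4 : 0 < eps ^+ 2 / (1 + N [:: (1, x)]) by rewrite divr_gt0 ?exprn_gt0.
  move/cvgrPdist_le : ecvg => /(_ _ h4); apply: filterS => n.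
  rewrite sub0r normrN gtr0_norm// ler_pdivlMr//.
  move=> h; rewrite distrC -(ler_pXn2r (ltn0Sn 1)) ?nnegrE//; last exact: ltW.
  rewrite real_normK ?num_real//.
  (* Evaluation at [x] is the pairing with the unit point mass at [x], so [key] applies to it. *)
  have Dw : comb_pts D [:: (1 : R, x)] by [].
  have := key n _ Dw; rewrite -comb_apply_eval /L /comb_apply !big_seq1/= !mul1r.
  move=> /le_trans; apply; apply: le_trans h.
  by rewrite ler_pM2l// lerDr.
(* At an exact minimiser [N = L], hence [J = - N]; the norms therefore tend to [sqrt (- j)].
   Quantitatively [N + j = 2 (N - L) - (J - j)], with [N - L] bounded by [key] at [w = v n]. *)
- exists (Num.sqrt (- j)); split; last first.
    by rewrite -[leRHS](ger0_norm c0) -sqrtr_sqr ler_wsqrtr// lerNl.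
  apply: (@continuous_cvg _ _ _ _ _ (fun n => N (v n)) Num.sqrt (- j)); first exact: sqrt_continuous.
  apply/cvgrPdist_le => eps eps0.
  pose b : R := 4 * c ^+ 2 + 2.
  have b0 : 0 < b by rewrite /b ltr_pwDr// mulr_ge0// sqr_ge0.
  have h4 : 0 < Num.min (eps / 2) (eps ^+ 2 / (16 * b)).
    by rewrite lt_min !divr_gt0 ?exprn_gt0// mulr_gt0.
  move/cvgrPdist_le : ecvg => /(_ _ h4); apply: filterS => n.
  rewrite sub0r normrN gtr0_norm// le_min => /andP[en1]; rewrite ler_pdivlMr ?mulr_gt0// => en2.
  have := key n (v n) (Dv n); have := jJ _ (Dv n); have := Jv n.
  rewrite /J -[comb_inner _ _ _]/(N (v n)) => h1 h2 h3.
  have h5 : (N (v n) - L (v n)) ^+ 2 <= (eps / 4) ^+ 2.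
    apply: (le_trans h3); apply: (@le_trans _ _ (e n * b)); first by rewrite ler_wpM2l ?Nb// ltW.
    by move: en2; lra.
  have : `|N (v n) - L (v n)| <= eps / 4.
    by rewrite -(ler_pXn2r (ltn0Sn 1)) ?nnegrE ?divr_ge0 ?(ltW eps0)// real_normK ?num_real.
  rewrite !ler_norml => /andP[h6 h7].
  by apply/andP; split; lra.
Unshelve. all: end_near. Qed.

End Duality.

(** * Real-valued integrals and Riemann sums over fine partitions *)

Section RealIntegral.
Context {d : measure_display} {T : measurableType d} {R : realType}.
Variables (mu : {measure set T -> \bar R}) (D : set T).
Hypothesis mD : measurable D.
Implicit Types f g : T -> R.

Local Notation intg f := (mu.-integrable D (EFin \o f)).

Lemma integrable_measurable f : intg f -> measurable_fun D f.
Proof. by move=> /measurable_int/measurable_EFinP. Qed.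

Lemma integrable_add f g : intg f -> intg g -> intg (fun x => f x + g x).
Proof. by move=> fi gi; exact: (integrableD mD fi gi). Qed.

Lemma integrable_sub f g : intg f -> intg g -> intg (fun x => f x - g x).
Proof. by move=> fi gi; exact: (integrableB mD fi gi). Qed.

Lemma integrable_scale c f : intg f -> intg (fun x => c * f x).
Proof. by move=> fi; exact: (integrableZl mD c fi). Qed.

Lemma integrable_bigsum (I : Type) (s : seq I) (F : I -> T -> R) :
  (forall i, intg (F i)) -> intg (fun x => \sum_(i <- s) F i x).
Proof.
move=> iF; have := integrable_sum mD s (fun i (_ : predT i) => iF i).
by apply: eq_integrable => // x _ /=; rewrite sumEFin.
Qed.

Lemma integrable_le f g : measurable_fun D f -> intg g ->
  (forall x, D x -> `|f x| <= g x) -> intg f.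
Proof.
move=> mf gi fg; apply: (le_integrable mD _ _ gi); first exact/measurable_EFinP.
by move=> x Dx /=; rewrite lee_fin (le_trans (fg _ Dx))// ler_norm.
Qed.

Lemma integrable_bounded (M : R) f : (mu D < +oo)%E -> measurable_fun D f ->
  (forall x, D x -> `|f x| <= M) -> intg f.
Proof.
move=> muD mf fM; apply: measurable_bounded_integrable => //.
by exists M; split; [exact: num_real|move=> N MN x /fM/le_trans; apply; exact: ltW].
Qed.

Lemma integrable_mul_bounded (M : R) f g : intg f -> measurable_fun D g ->
  (forall x, D x -> `|g x| <= M) -> intg (fun x => f x * g x).
Proof.
move=> fi mg gM; apply: (@integrable_le _ (fun x => M * `|f x|)).
- by apply: measurable_funM => //; exact: integrable_measurable.
- exact/integrable_scale/integrable_norm.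
- by move=> x Dx; rewrite normrM mulrC ler_wpM2r// gM.
Qed.

Lemma Rintegral_bigsum (I : Type) (s : seq I) (F : I -> T -> R) :
  (forall i, intg (F i)) ->
  \int[mu]_(x in D) (\sum_(i <- s) F i x) = \sum_(i <- s) \int[mu]_(x in D) F i x.
Proof.
move=> iF; elim: s => [|i s IH].
  rewrite big_nil; under eq_Rintegral do rewrite big_nil.
  by rewrite Rintegral_cst// mul0r.
rewrite big_cons -IH -RintegralD//; last exact: integrable_bigsum.
by apply: eq_Rintegral => x _; rewrite big_cons.
Qed.

Lemma normr_Rintegral_le f g : intg f -> intg g ->
  (forall x, D x -> `|f x| <= g x) ->
  `|\int[mu]_(x in D) f x| <= \int[mu]_(x in D) g x.
Proof.
move=> fi gi fg; apply: (le_trans (le_normr_Rintegral mD fi)).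
by apply: le_Rintegral => //; exact: integrable_norm.
Qed.

End RealIntegral.

Section FinePartition.
Context {d : measure_display} {T : measurableType d} {R : realType}.
Variables (D : set T).
Hypothesis mD : measurable D.

(** Stands in for uniform continuity on a compact set. The cells are the fibres of [pi], so
    [g (x (pi y))] is the step function sampled from [g]. The relation is left arbitrary so that one
    partition can be fine for several functions at once. *)
Definition fine_partition (rel : T -> T -> Prop) : Prop :=
  exists N (x : 'I_N.+1 -> T) (pi : T -> 'I_N.+1),
    [/\ forall i, D (x i), forall i, measurable (D `&` pi @^-1` [set i]) &
        forall y, D y -> rel (x (pi y)) y].

Lemma fine_partition_sub (r1 r2 : T -> T -> Prop) :
  (forall x y, D x -> D y -> r1 x y -> r2 x y) ->
  fine_partition r1 -> fine_partition r2.
Proof.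
move=> r12 [N [x [pi [Dx mpi xpi]]]]; exists N, x, pi; split => // y Dy.
by apply: r12 => //; exact: xpi.
Qed.

Definition uosc (g : T -> R) : Prop :=
  forall e : R, 0 < e -> fine_partition (fun x y => `|g x - g y| <= e).

Section Cells.
Variables (N : nat) (pi : T -> 'I_N.+1).
Hypothesis mpi : forall i, measurable (D `&` pi @^-1` [set i]).

Definition cell (i : 'I_N.+1) : set T := D `&` pi @^-1` [set i].

Lemma cell_indicE (c : 'I_N.+1 -> R) y : D y ->
  c (pi y) = \sum_i c i * \1_(cell i) y.
Proof.
move=> Dy; rewrite (bigD1 (pi y))//= big1 ?addr0; last first.
  by move=> i ipi; rewrite indicE memNset ?mulr0// => -[_ /= h]; rewrite h eqxx in ipi.
by rewrite indicE mem_set ?mulr1.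
Qed.

Lemma measurable_cells (c : 'I_N.+1 -> R) : measurable_fun D (fun y => c (pi y)).
Proof.
apply: (@eq_measurable_fun _ _ _ _ D (fun y => \sum_i c i * \1_(cell i) y)).
  by move=> y; rewrite inE => Dy; rewrite cell_indicE.
apply: measurable_sum => i; apply: measurable_funM => //.
exact/measurable_indic/mpi.
Qed.

Variables (mu : {measure set T -> \bar R}) (phi : T -> R).
Hypothesis iphi : mu.-integrable D (EFin \o phi).

(** The weights of the point masses at the tags that imitate the density [phi]. *)
Definition cell_mass i : R := \int[mu]_(y in D) (phi y * \1_(cell i) y).

Lemma integrable_cell i : mu.-integrable D (EFin \o (fun y => phi y * \1_(cell i) y)).
Proof.
apply: (@integrable_mul_bounded _ _ _ _ _ _ 1) => //; first exact/measurable_indic/mpi.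
by move=> y _; rewrite indicE; case: (_ \in _); rewrite ?normr1 ?normr0.
Qed.

Lemma sum_cell_mass (c : 'I_N.+1 -> R) :
  \sum_i cell_mass i * c i = \int[mu]_(y in D) (phi y * c (pi y)).
Proof.
under [RHS]eq_Rintegral.
  move=> y; rewrite inE => Dy; rewrite cell_indicE// mulr_sumr.
  under eq_bigr do rewrite mulrCA.
  over.
rewrite Rintegral_bigsum// => [|i]; last exact/integrable_scale/integrable_cell.
by apply: eq_bigr => i _; rewrite mulrC RintegralZl//; exact: integrable_cell.
Qed.

Lemma sum_norm_cell_mass : \sum_i `|cell_mass i| <= \int[mu]_(y in D) `|phi y|.
Proof.
(* Inserting signs turns the sum into the integral of [phi] against a step function with values in
   [{-1, 0, 1}]. *)
have -> : \sum_i `|cell_mass i| = \sum_i cell_mass i * Num.sg (cell_mass i).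
  by apply: eq_bigr => i _; rewrite mulrC -normrEsg.
rewrite (sum_cell_mass (fun i => Num.sg (cell_mass i))).
apply: (le_trans (ler_norm _)); apply: normr_Rintegral_le => //.
- apply: (@integrable_mul_bounded _ _ _ _ _ _ 1) => //; first exact: (measurable_cells (fun i => Num.sg (cell_mass i))).
  by move=> y _; rewrite normr_sg lern1 leq_b1.
- exact: integrable_norm.
- by move=> y _; rewrite normrM ler_piMr// normr_sg lern1 leq_b1.
Qed.

Lemma riemann_sum (g : T -> R) (x : 'I_N.+1 -> T) (e : R) :
  mu.-integrable D (EFin \o (fun y => phi y * g y)) ->
  (forall y, D y -> `|g (x (pi y)) - g y| <= e) ->
  `|\sum_i cell_mass i * g (x i) - \int[mu]_(y in D) (phi y * g y)|
    <= e * \int[mu]_(y in D) `|phi y|.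
Proof.
move=> ig ge; rewrite (sum_cell_mass (fun i => g (x i))).
have istep : mu.-integrable D (EFin \o (fun y => phi y * g (x (pi y)))).
  apply: (@integrable_mul_bounded _ _ _ _ _ _ (\sum_i `|g (x i)|)) => //.
    exact: (measurable_cells (fun i => g (x i))).
  by move=> y _; rewrite (bigD1 (pi y))//= lerDl sumr_ge0.
rewrite -RintegralB// -RintegralZl//; last exact: integrable_norm.
apply: normr_Rintegral_le => //.
- exact: integrable_sub.
- exact/integrable_scale/integrable_norm.
- by move=> y Dy; rewrite -mulrBr normrM mulrC ler_wpM2r// ge.
Qed.

End Cells.

Lemma uosc_measurable (g : T -> R) : uosc g -> measurable_fun D g.
Proof.
move=> ug.
have /choice[s sP] (n : nat) : exists s : T -> R, measurable_fun D s /\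
    forall y, D y -> `|s y - g y| <= n.+1%:R^-1.
  have [N [x [pi [Dx mpi xpi]]]] := ug n.+1%:R^-1 ltac:(by rewrite invr_gt0).
  by exists (fun y => g (x (pi y))); split => //; exact: (measurable_cells mpi (fun i => g (x i))).
apply: (@measurable_fun_cvg _ _ _ D s); first by move=> n; case: (sP n).
move=> y Dy; apply/cvgrPdist_le => e e0.
move/cvgrPdist_le : (@cvg_harmonic R) => /(_ _ e0); apply: filterS => n.
rewrite sub0r normrN distrC => h; apply: le_trans (le_trans (ler_norm _) h).
exact: (sP n).2.
Qed.

Lemma uosc_bounded (g : T -> R) : uosc g -> exists M, forall y, D y -> `|g y| <= M.
Proof.
move=> /(_ 1 ltr01)[N [x [pi [Dx mpi xpi]]]].
exists (1 + \sum_i `|g (x i)|) => y Dy.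
rewrite -[g y](subrK (g (x (pi y)))) (le_trans (ler_normD _ _))// lerD//.
  by rewrite distrC xpi.
by rewrite (bigD1 (pi y))//= lerDl sumr_ge0.
Qed.

End FinePartition.

(** * The space [L2] and the integral operator *)

(** Dropping [(s - q)^2] leaves an error linear in [e], the shape that [ler0_of_forall] consumes. *)
Lemma sqr_close_le (R : realType) (q s e : R) : `|s - q| <= e ->
  q ^+ 2 - 2 * `|q| * e <= s ^+ 2.
Proof.
move=> sq; have : `|q * (s - q)| <= `|q| * e by rewrite normrM ler_wpM2l.
rewrite ler_norml => /andP[+ _]; have : 0 <= (s - q) ^+ 2 by exact: sqr_ge0.
by move: `|q| => a; lra.
Qed.

Definition lincomb {R : realType} {T : Type} (n : nat) (c : nat -> R)
  (psi : nat -> T -> R) : T -> R := fun x => \sum_(i < n) c i * psi i x.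

Section L2Theory.
Context {d : measure_display} {T : measurableType d} {R : realType}.
Variables (rho : probability T R) (D : set T).
Hypothesis mD : measurable D.
Implicit Types f g h : T -> R.

Local Notation intg f := (rho.-integrable D (EFin \o f)).
Local Notation L2 := (L2fun rho D).
Local Notation ip := (L2inner rho D).

Lemma prob_lt_pinfty : (rho D < +oo)%E.
Proof. by rewrite (le_lt_trans (probability_le1 _ _))// ltry. Qed.

Lemma L2_bounded (M : R) f : measurable_fun D f ->
  (forall x, D x -> `|f x| <= M) -> L2 f.
Proof.
move=> mf fM; split=> //.
apply: (@integrable_bounded _ _ _ _ _ mD (M ^+ 2) (fun x => f x ^+ 2)).
- exact: prob_lt_pinfty.
- exact: measurable_funX.
- by move=> x Dx; rewrite normrX ler_pXn2r ?nnegrE ?fM// (le_trans _ (fM _ Dx)).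
Qed.

Lemma L2_cst (c : R) : L2 (cst c).
Proof. by apply: (@L2_bounded `|c|) => //; exact: measurable_cst. Qed.

Lemma L2_mul f g : L2 f -> L2 g -> intg (fun x => f x * g x).
Proof.
move=> [mf if2] [mg ig2].
apply: (@integrable_le _ _ _ _ _ mD _ (fun x => f x ^+ 2 + g x ^+ 2)).
- exact: measurable_funM.
- exact: (integrable_add mD if2 ig2).
- move=> x Dx; rewrite normrM -[f x ^+ 2]real_normK ?num_real//.
  rewrite -[g x ^+ 2]real_normK ?num_real//.
  have : 0 <= (`|f x| - `|g x|) ^+ 2 by exact: sqr_ge0.
  have : 0 <= `|f x| * `|g x| by rewrite mulr_ge0.
  nra.
Qed.

Lemma L2_integrable f : L2 f -> intg f.
Proof.
move=> Lf; have := L2_mul (L2_cst 1) Lf.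
by apply: eq_integrable => // x _ /=; rewrite mul1r.
Qed.

Lemma L2_add f g : L2 f -> L2 g -> L2 (f \+ g).
Proof.
move=> Lf Lg; split; first exact: (measurable_funD Lf.1 Lg.1).
have h : intg (fun x => (f x ^+ 2 + 2 * (f x * g x)) + g x ^+ 2).
  apply: integrable_add => //; last exact: Lg.2.
  apply: integrable_add => //; first exact: Lf.2.
  by apply: integrable_scale => //; exact: L2_mul.
apply: eq_integrable h => // x _ /=; congr EFin; ring.
Qed.

Lemma L2_scale (c : R) f : L2 f -> L2 (c \*o f).
Proof.
move=> Lf; split; first by apply: measurable_funM => //; exact: Lf.1.
have := @integrable_scale _ _ _ _ _ mD (c ^+ 2) (fun x => f x ^+ 2) Lf.2.
by apply: eq_integrable => // x _ /=; rewrite exprMn.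
Qed.

Lemma L2_sub f g : L2 f -> L2 g -> L2 (f \- g).
Proof.
move=> Lf Lg; have := L2_add Lf (L2_scale (-1) Lg); congr L2fun.
by apply/funext => x /=; rewrite mulN1r.
Qed.

Lemma L2_lincomb n c psi : (forall i, L2 (psi i)) -> L2 (lincomb n c psi).
Proof.
move=> Lpsi; elim: n => [|n IH].
  have := L2_cst 0; congr L2fun.
  by apply/funext => x; rewrite /lincomb big_ord0.
have := L2_add IH (L2_scale (c n) (Lpsi n)); congr L2fun.
by apply/funext => x; rewrite /lincomb big_ord_recr.
Qed.

Lemma L2innerC f g : ip f g = ip g f.
Proof. by apply: eq_Rintegral => x _; rewrite mulrC. Qed.

Lemma L2innerDl f g h : L2 f -> L2 g -> L2 h -> ip (f \+ g) h = ip f h + ip g h.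
Proof.
move=> Lf Lg Lh; rewrite /L2inner -RintegralD//; [|exact: L2_mul..].
by apply: eq_Rintegral => x _ /=; rewrite mulrDl.
Qed.

Lemma L2innerZl c f h : L2 f -> L2 h -> ip (c \*o f) h = c * ip f h.
Proof.
move=> Lf Lh; rewrite /L2inner -RintegralZl//; last exact: L2_mul.
by apply: eq_Rintegral => x _ /=; rewrite mulrA.
Qed.

Lemma L2innerBl f g h : L2 f -> L2 g -> L2 h -> ip (f \- g) h = ip f h - ip g h.
Proof.
move=> Lf Lg Lh; rewrite /L2inner -RintegralB//; [|exact: L2_mul..].
by apply: eq_Rintegral => x _ /=; rewrite mulrBl.
Qed.

Lemma L2innerDr f g h : L2 f -> L2 g -> L2 h -> ip h (f \+ g) = ip h f + ip h g.
Proof. by move=> *; rewrite !(L2innerC h) L2innerDl. Qed.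

Lemma L2innerZr c f h : L2 f -> L2 h -> ip h (c \*o f) = c * ip h f.
Proof. by move=> *; rewrite !(L2innerC h) L2innerZl. Qed.

Lemma L2innerBr f g h : L2 f -> L2 g -> L2 h -> ip h (f \- g) = ip h f - ip h g.
Proof. by move=> *; rewrite !(L2innerC h) L2innerBl. Qed.

Lemma L2inner_lincombl n c psi h : (forall i, L2 (psi i)) -> L2 h ->
  ip (lincomb n c psi) h = \sum_(i < n) c i * ip (psi i) h.
Proof.
move=> Lpsi Lh; under eq_bigr do rewrite -L2innerZl//.
rewrite /L2inner -Rintegral_bigsum// => [|i]; last by apply: L2_mul => //; exact: L2_scale.
by apply: eq_Rintegral => x _; rewrite /lincomb mulr_suml.
Qed.

Lemma L2inner_ge0 f : 0 <= ip f f.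
Proof. by apply: Rintegral_ge0 => x _; rewrite -expr2 sqr_ge0. Qed.

Lemma L2dist2E f g : L2dist2 rho D f g = ip (f \- g) (f \- g).
Proof. by apply: eq_Rintegral => x _; rewrite expr2. Qed.

Lemma L2_CauchySchwarz f g : L2 f -> L2 g -> ip f g ^+ 2 <= ip f f * ip g g.
Proof.
move=> Lf Lg; apply: discriminant_le; first exact: L2inner_ge0.
move=> t; have Ltg := L2_scale t Lg; have := L2inner_ge0 (f \+ (t \*o g)).
rewrite L2innerDl// ?L2innerDr//; [|exact: L2_add..].
rewrite !L2innerZl// !L2innerZr// (L2innerC g f).
by congr (0 <= _); ring.
Qed.

Definition L1norm f : R := \int[rho]_(x in D) `|f x|.

Lemma L1norm_ge0 f : 0 <= L1norm f.
Proof. by apply: Rintegral_ge0 => x _. Qed.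

Lemma L2_norm f : L2 f -> L2 (fun x => `|f x|).
Proof.
move=> Lf; split; first by apply: measurableT_comp => //; exact: Lf.1.
by apply: eq_integrable Lf.2 => // x _ /=; rewrite real_normK ?num_real.
Qed.

Lemma L1norm_sqr_le f : L2 f -> L1norm f ^+ 2 <= ip f f.
Proof.
move=> Lf; have := L2_CauchySchwarz (L2_norm Lf) (L2_cst 1).
have -> : ip (fun x => `|f x|) (cst 1) = L1norm f.
  by apply: eq_Rintegral => x _ /=; rewrite mulr1.
have -> : ip (fun x => `|f x|) (fun x => `|f x|) = ip f f.
  by apply: eq_Rintegral => x _; rewrite -!expr2 real_normK ?num_real.
move=> /le_trans; apply; rewrite ler_piMr ?L2inner_ge0//.
rewrite /L2inner; under eq_Rintegral do rewrite /= mulr1.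
rewrite Rintegral_cst// mul1r -lee_fin fineK ?probability_le1//.
by rewrite ge0_fin_numE// prob_lt_pinfty.
Qed.

Lemma L2inner_bounded (e : R) f g : L2 f -> L2 g ->
  (forall x, D x -> `|f x| <= e) -> `|ip f g| <= e * L1norm g.
Proof.
move=> Lf Lg fe; rewrite /L1norm -RintegralZl//; last first.
  by apply: integrable_norm; exact: L2_integrable.
apply: normr_Rintegral_le => //.
- exact: L2_mul.
- by apply: integrable_scale => //; apply: integrable_norm; exact: L2_integrable.
- by move=> x Dx; rewrite normrM ler_wpM2r// fe.
Qed.

End L2Theory.

(** * The integral operator through double Riemann sums *)

Section IntegralOperator.
Context {d : measure_display} {T : measurableType d} {R : realType}.
Variables (rho : probability T R) (D : set T) (k : T -> T -> R).
Hypothesis mD : measurable D.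
Hypothesis kpd : pos_def_kernel D k.

(** Uniformity in [z] gives all functions [K phi] with bounded [L1norm phi] the same modulus of
    variation. *)
Definition kclose (e : R) (x y : T) : Prop :=
  forall z, D z -> `|k x z - k y z| <= e.

Hypothesis kfine : forall e : R, 0 < e -> fine_partition D (kclose e).

Implicit Types f g phi : T -> R.
Local Notation L2 := (L2fun rho D).
Local Notation ip := (L2inner rho D).
Local Notation K := (intop rho D k).
Local Notation L1norm := (L1norm rho D).

Lemma intopE phi x : K phi x = ip (k x) phi.
Proof. by []. Qed.

Lemma kernel_uosc x : D x -> uosc D (k x).
Proof.
move=> Dx e e0; apply: fine_partition_sub (kfine e0) => y z Dy Dz /(_ x Dx).
by rewrite !(kpd.1 x).
Qed.

Lemma kernel_bounded : exists M : R, 0 < M /\ forall x y, D x -> D y -> `|k x y| <= M.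
Proof.
have [N [x [pi [Dx mpi xpi]]]] := kfine ltr01.
exists (2 + \sum_i \sum_j `|k (x i) (x j)|); split.
  by rewrite ltr_pwDl// sumr_ge0// => i _; rewrite sumr_ge0.
move=> y z Dy Dz.
(* Both arguments are moved to their tags, one after the other by symmetry; each move costs 1, hence
   the 2 in the bound. *)
have -> : k y z = (k y z - k (x (pi y)) z) + (k z (x (pi y)) - k (x (pi z)) (x (pi y)))
    + k (x (pi y)) (x (pi z)).
  rewrite (kpd.1 z (x (pi y)))// (kpd.1 (x (pi z)))//; ring.
rewrite (le_trans (ler_normD _ _))// lerD//.
  rewrite (le_trans (ler_normD _ _))// (_ : 2 = 1 + 1)// lerD//.
    by rewrite distrC xpi.
  by rewrite distrC xpi.
rewrite (bigD1 (pi y))//= (bigD1 (pi z))//= -addrA lerDl addr_ge0// ?sumr_ge0//.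
by move=> i _; rewrite sumr_ge0.
Qed.

Lemma L2_kernel x : D x -> L2 (k x).
Proof.
move=> Dx; have [M [M0 kM]] := kernel_bounded.
apply: (@L2_bounded _ _ _ _ _ mD M); first exact: (uosc_measurable (kernel_uosc Dx)).
by move=> y; exact: kM.
Qed.

Lemma intop_close (e : R) phi x y : L2 phi -> D x -> D y -> kclose e x y ->
  `|K phi x - K phi y| <= e * L1norm phi.
Proof.
move=> Lphi Dx Dy xy; rewrite !intopE -L2innerBl//; [|exact: L2_kernel..].
apply: (L2inner_bounded mD) => //; by apply: L2_sub => //; exact: L2_kernel.
Qed.

Lemma L1norm1_gt0 phi : 0 < L1norm phi + 1.
Proof. by rewrite ltr_wpDl// L1norm_ge0. Qed.

Lemma intop_uosc phi : L2 phi -> uosc D (K phi).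
Proof.
move=> Lphi e e0; have e0' := divr_gt0 e0 (L1norm1_gt0 phi).
apply: fine_partition_sub (kfine e0') => x y Dx Dy xy.
apply: (le_trans (intop_close Lphi Dx Dy xy)).
by rewrite mulrAC ler_pdivrMr ?L1norm1_gt0// ler_pM2l// lerDl.
Qed.

Lemma L2_intop phi : L2 phi -> L2 (K phi).
Proof.
move=> /intop_uosc Ku; have [M KM] := uosc_bounded Ku.
by apply: (@L2_bounded _ _ _ _ _ mD M) => //; exact: (uosc_measurable Ku).
Qed.

Lemma L2_uosc g : uosc D g -> L2 g.
Proof.
move=> gu; have [M gM] := uosc_bounded gu.
by apply: (@L2_bounded _ _ _ _ _ mD M) => //; exact: (uosc_measurable gu).
Qed.

(** Each half of the error is [e] times the two norms: one from the inner sums at the tags [x i],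
    one from the outer sum, since [K phi2] varies by at most [e * L1norm phi2] on a cell. *)
Lemma riemann_intop (e : R) N (x : 'I_N.+1 -> T) (pi : T -> 'I_N.+1) phi1 phi2 :
  (forall i, D (x i)) -> (forall i, measurable (D `&` pi @^-1` [set i])) ->
  (forall y, D y -> kclose e (x (pi y)) y) -> L2 phi1 -> L2 phi2 ->
  `|\sum_i \sum_j cell_mass D pi rho phi1 i * cell_mass D pi rho phi2 j * k (x i) (x j)
     - ip phi1 (K phi2)| <= 2 * e * (L1norm phi1 * L1norm phi2).
Proof.
move=> Dx mpi xpi L1 L2'.
set a := cell_mass D pi rho phi1; set b := cell_mass D pi rho phi2.
have -> : \sum_i \sum_j a i * b j * k (x i) (x j) - ip phi1 (K phi2) =
  (\sum_i a i * (\sum_j b j * k (x i) (x j) - K phi2 (x i))) +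
  (\sum_i a i * K phi2 (x i) - ip phi1 (K phi2)).
  rewrite addrA; congr (_ - _); rewrite -big_split/=; apply: eq_bigr => i _.
  rewrite -mulrDr subrK mulr_sumr; apply: eq_bigr => j _; rewrite mulrA//.
have inner i : `|\sum_j b j * k (x i) (x j) - K phi2 (x i)| <= e * L1norm phi2.
  rewrite intopE L2innerC; apply: (@riemann_sum _ _ _ D mD _ pi mpi rho phi2 _ (k (x i)) x) => //.
  - exact: L2_integrable.
  - by apply: L2_mul => //; exact: L2_kernel.
  - move=> y Dy; rewrite (kpd.1 (x i))// (kpd.1 (x i))//; exact: xpi.
have outer : `|\sum_i a i * K phi2 (x i) - ip phi1 (K phi2)| <= e * L1norm phi2 * L1norm phi1.
  apply: (@riemann_sum _ _ _ D mD _ pi mpi rho phi1 _ (K phi2) x) => //.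
  - exact: L2_integrable.
  - by apply: L2_mul => //; exact: L2_intop.
  - by move=> y Dy; apply: intop_close => //; exact: xpi.
rewrite (le_trans (ler_normD _ _))//.
rewrite (_ : 2 * e * _ = e * L1norm phi2 * L1norm phi1 + e * L1norm phi2 * L1norm phi1); last ring.
rewrite lerD// (le_trans (ler_norm_sum _ _ _))//.
apply: (@le_trans _ _ (\sum_i `|a i| * (e * L1norm phi2))).
  by apply: ler_sum => i _; rewrite normrM ler_wpM2l.
(* The sign of [e] is not assumed, but [kclose] between a tag and a point of [D] forces [0 <= e]. *)
rewrite -mulr_suml mulrC; have [e0|e0] := ltP e 0; last first.
  apply: ler_wpM2l; first by rewrite mulr_ge0// L1norm_ge0.
  by apply: sum_norm_cell_mass => //; exact: L2_integrable.
by have := le_trans (normr_ge0 _) (xpi _ (Dx ord0) _ (Dx ord0)); rewrite leNgt e0.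
Qed.

Lemma ler0_of_forall (c z : R) : 0 <= c -> (forall e, 0 < e -> z <= e * c) -> z <= 0.
Proof.
move=> c0 h; apply/ler_addgt0Pr => e e0; rewrite add0r.
have c1 : 0 < c + 1 by rewrite ltr_wpDl.
apply: (le_trans (h (e / (c + 1)) (divr_gt0 e0 c1))).
by rewrite mulrAC ler_pdivrMr// ler_pM2l// lerDl.
Qed.

Lemma intop_sym phi1 phi2 : L2 phi1 -> L2 phi2 -> ip phi1 (K phi2) = ip phi2 (K phi1).
Proof.
move=> L1 L2'; apply/eqP; rewrite -subr_eq0 -normr_le0.
apply: (@ler0_of_forall (4 * (L1norm phi1 * L1norm phi2))).
  by rewrite !mulr_ge0 ?L1norm_ge0.
move=> e e0; have [N [x [pi [Dx mpi xpi]]]] := kfine e0.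
have := riemann_intop Dx mpi xpi L1 L2'; have := riemann_intop Dx mpi xpi L2' L1.
set s1 := \sum_i _; set s2 := \sum_i _.
have -> : s1 = s2.
  rewrite /s1 exchange_big; apply: eq_bigr => i _; apply: eq_bigr => j _ /=.
  by rewrite (kpd.1 (x j))// (mulrC (cell_mass _ _ _ _ _)).
move: s2 (L1norm phi1) (L1norm phi2) (ip phi1 _) (ip phi2 _) => s2 n1 n2 z1 z2.
rewrite !ler_norml => /andP[? ?] /andP[? ?]; apply/andP; split; lra.
Qed.

Lemma sum_cells_comb N (x : 'I_N.+1 -> T) (a : 'I_N.+1 -> R) (F : R * T -> R) :
  \sum_(p <- [seq (a i, x i) | i <- enum 'I_N.+1]) F p = \sum_i F (a i, x i).
Proof. by rewrite big_map big_enum. Qed.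

Lemma comb_pts_cells N (x : 'I_N.+1 -> T) (a : 'I_N.+1 -> R) : (forall i, D (x i)) ->
  comb_pts D [seq (a i, x i) | i <- enum 'I_N.+1].
Proof. by move=> Dx; elim: (enum _) => //= i s IH; split. Qed.

Lemma comb_norm2_cells N (x : 'I_N.+1 -> T) (a : 'I_N.+1 -> R) :
  comb_norm2 k [seq (a i, x i) | i <- enum 'I_N.+1] =
  \sum_i \sum_j a i * a j * k (x i) (x j).
Proof.
by rewrite /comb_norm2 sum_cells_comb; apply: eq_bigr => i _; rewrite sum_cells_comb.
Qed.

Lemma intop_ge0 phi : L2 phi -> 0 <= ip phi (K phi).
Proof.
move=> L1; rewrite -oppr_le0.
apply: (@ler0_of_forall (2 * (L1norm phi * L1norm phi))).
  by rewrite !mulr_ge0 ?L1norm_ge0.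
move=> e e0; have [N [x [pi [Dx mpi xpi]]]] := kfine e0.
have := riemann_intop Dx mpi xpi L1 L1; rewrite -comb_norm2_cells.
have := comb_norm2_ge0 kpd (comb_pts_cells (cell_mass D pi rho phi) Dx).
rewrite ler_norml => ? /andP[? ?]; lra.
Qed.

Lemma intop_CauchySchwarz phi1 phi2 : L2 phi1 -> L2 phi2 ->
  ip phi1 (K phi2) ^+ 2 <= ip phi1 (K phi1) * ip phi2 (K phi2).
Proof.
move=> L1 L2'; apply: discriminant_le; first exact: intop_ge0.
move=> t; have Lt := L2_scale mD t L2'; have Ls := L2_add mD L1 Lt.
have := intop_ge0 Ls; have LK f := @L2_intop f.
rewrite (L2innerDl mD L1 Lt (LK _ Ls)) (intop_sym L1 Ls) (intop_sym Lt Ls).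
rewrite (L2innerDl mD L1 Lt (LK _ L1)) (L2innerDl mD L1 Lt (LK _ Lt)).
rewrite (intop_sym L1 Lt) !(L2innerZl mD t L2' (LK _ _)) //.
rewrite (intop_sym L2' Lt) (L2innerZl mD t L2' (LK _ L2')) (intop_sym L2' L1).
move: (ip phi1 (K phi1)) (ip phi1 (K phi2)) (ip phi2 (K phi2)) => a b c.
by congr (0 <= _); ring.
Qed.

(** One partition must serve both [k] and [g], because the same combination approximates both sides
    of the inequality. *)
Definition kuosc g : Prop :=
  forall e : R, 0 < e -> fine_partition D (fun x y => kclose e x y /\ `|g x - g y| <= e).

Lemma kuosc_uosc g : kuosc g -> uosc D g.
Proof. by move=> gu e e0; apply: fine_partition_sub (gu e e0) => x y _ _ []. Qed.

Lemma dominated_L2 g (B : R) phi : dominated D k g B -> kuosc g -> L2 phi ->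
  ip phi g ^+ 2 <= B ^+ 2 * ip phi (K phi).
Proof.
move=> gB gu Lphi; have Lg := L2_uosc (kuosc_uosc gu).
set n := L1norm phi; set q := ip phi g; set Q := ip phi (K phi).
have n0 : 0 <= n by exact: L1norm_ge0.
rewrite -subr_le0.
(* The first term is the loss of [sqr_close_le] for [ip phi g], the second that of [riemann_intop]
   for [ip phi (K phi)]. *)
apply: (@ler0_of_forall (2 * `|q| * n + B ^+ 2 * (2 * (n * n)))).
  have B0 : 0 <= B ^+ 2 by exact: sqr_ge0.
  by apply: addr_ge0; apply: mulr_ge0 => //; rewrite !mulr_ge0.
move=> e e0; have [N [x [pi [Dx mpi xpi]]]] := gu e e0.
have mpi' y : D y -> kclose e (x (pi y)) y by move=> /xpi[].
have := riemann_intop Dx mpi mpi' Lphi Lphi; rewrite -comb_norm2_cells.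
set v := [seq _ | i <- _].
have Dv : comb_pts D v by exact: comb_pts_cells.
have := gB v Dv; rewrite {1}/comb_apply sum_cells_comb /=.
have h : `|\sum_i cell_mass D pi rho phi i * g (x i) - q| <= e * n.
  apply: (@riemann_sum _ _ _ D mD _ pi mpi rho phi _ g x) => //.
  - exact: L2_integrable.
  - exact: L2_mul.
  - by move=> y /xpi[].
move: h; set s := \sum_i _; rewrite -/n -/Q => /sqr_close_le sq h3.
rewrite ler_norml => /andP[h4 h5].
have : B ^+ 2 * comb_norm2 k v <= B ^+ 2 * (Q + 2 * e * (n * n)).
  by rewrite ler_wpM2l ?sqr_ge0//; move: h5; lra.
by move: h3 sq; move: (B ^+ 2) `|q| (comb_norm2 k v) => B2 a b; lra.
Qed.

End IntegralOperator.

(** * Spectral estimates *)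

Lemma ultra_fmap (T U : Type) (f : T -> U) (F : set_system T) :
  UltraFilter F -> UltraFilter (f @ F).
Proof.
move=> FU; split; first exact: fmap_proper_filter.
move=> G GF FG; apply/seteqP; split=> [A GA|//].
have [//|FnA] := in_ultra_setVsetC (f @^-1` A) FU.
have GnA : G (~` A) by apply: FG.
have : G set0 by rewrite -(setICr A); exact: filterI.
by move=> /filter_not_empty.
Qed.

Lemma ultra_cvg_bounded (R : realType) (T : Type) (F : set_system T) (f : T -> R) (M : R) :
  UltraFilter F -> (forall t, `|f t| <= M) -> exists l : R, f t @[t --> F] --> l.
Proof.
move=> FU fM; have := @segment_compact R (- M) M; rewrite compact_ultra.
move=> /(_ _ (ultra_fmap f FU)) [|l [_ fl]]; last by exists l.
by apply: (@filterE _ F) => t /=; rewrite in_itv/= -ler_norml.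
Qed.

(** * Compactness of the integral operator *)

Section IntegralOperatorCompact.
Context {d : measure_display} {T : measurableType d} {R : realType}.
Variables (rho : probability T R) (D : set T) (k : T -> T -> R).
Hypothesis mD : measurable D.
Hypothesis kpd : pos_def_kernel D k.
Hypothesis kfine : forall e : R, 0 < e -> fine_partition D (kclose D k e).

Implicit Types f g phi : T -> R.
Local Notation L2 := (L2fun rho D).
Local Notation ip := (L2inner rho D).
Local Notation K := (intop rho D k).
Local Notation L1norm := (L1norm rho D).

Lemma L1norm_le1 phi : L2 phi -> ip phi phi <= 1 -> L1norm phi <= 1.
Proof.
move=> Lphi phi1; rewrite -(ler_pXn2r (ltn0Sn 1)) ?nnegrE ?L1norm_ge0//.
by rewrite expr1n (le_trans (L1norm_sqr_le mD Lphi)).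
Qed.

Lemma intop_bounded (M : R) phi x : (forall x y, D x -> D y -> `|k x y| <= M) ->
  L2 phi -> D x -> `|K phi x| <= M * L1norm phi.
Proof.
move=> kM Lphi Dx; rewrite intopE; apply: (L2inner_bounded mD) => //.
  exact: (L2_kernel _ mD kpd kfine).
by move=> y Dy; exact: kM.
Qed.

Lemma uosc_uniform_limit w :
  (forall e : R, 0 < e -> exists f, uosc D f /\ forall x, D x -> `|f x - w x| <= e) ->
  uosc D w.
Proof.
move=> h e e0; have e3 : 0 < e / 3 by rewrite divr_gt0.
have [f [fu fw]] := h _ e3.
apply: fine_partition_sub (fu _ e3) => x y Dx Dy.
move: (fw x Dx) (fw y Dy); rewrite !ler_norml => /andP[? ?] /andP[? ?] /andP[? ?].
by apply/andP; split; lra.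
Qed.

(* Arzela-Ascoli, with an ultrafilter in place of a subsequence. *)
Lemma intop_compact (Phi : nat -> T -> R) :
  (forall m, L2 (Phi m)) -> (forall m, ip (Phi m) (Phi m) <= 1) ->
  exists w : T -> R, forall (e : R) (m0 : nat), 0 < e ->
    exists m, (m0 <= m)%N /\ forall x, D x -> `|K (Phi m) x - w x| <= e.
Proof.
move=> LP P1; have [M [M0 kM]] := kernel_bounded kpd kfine.
have PL1 m : L1norm (Phi m) <= 1 by exact: L1norm_le1.
(* [U] refines [\oo]: bounded sequences converge along it, at all points [x] simultaneously, and
   each of its sets contains arbitrarily large indices. *)
have [U [UU oU]] := ultraFilterLemma (_ : ProperFilter \oo).
have /choice[w wP] x : exists l : R, D x -> K (Phi m) x @[m --> U] --> l.
  have [Dx|nDx] := pselect (D x); last by exists 0.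
  have [l lP] : exists l : R, K (Phi m) x @[m --> U] --> l; last by exists l.
  apply: (@ultra_cvg_bounded _ _ _ (fun m => K (Phi m) x) M) => // m.
  by rewrite (le_trans (intop_bounded kM (LP m) Dx))// ler_piMr// ltW.
exists w => e m0 e0; have e3 : 0 < e / 3 by rewrite divr_gt0.
have [N [x [pi [Dx mpi xpi]]]] := kfine e3.
have KP m y z : D y -> D z -> kclose D k (e / 3) y z ->
    `|K (Phi m) y - K (Phi m) z| <= e / 3.
  move=> Dy Dz yz; rewrite (le_trans (intop_close mD kpd kfine (LP m) Dy Dz yz))//.
  by rewrite ler_piMr// ltW.
have wyz y z : D y -> D z -> kclose D k (e / 3) y z -> `|w y - w z| <= e / 3.
  move=> Dy Dz yz.
  have h : K (Phi m) y - K (Phi m) z @[m --> U] --> w y - w z.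
    by apply: cvgB; exact: wP.
  by apply: (cvgr_to_le (cvg_norm h)); apply: nearW => m; exact: KP.
(* Convergence at the finitely many tags yields one common [m]; the uniform modulus in [KP] and
   [wyz] then carries the estimate to all of [D]. *)
have [m [mm0 mP]] : exists m, (m0 <= m)%N /\
    forall i : 'I_N.+1, `|K (Phi m) (x i) - w (x i)| <= e / 3.
  apply: (@filter_ex _ U); apply: filterI; first by apply: oU; exists m0.
  apply: filter_forall => i.
  have /cvgrPdist_le/(_ _ e3) := wP _ (Dx i).
  by apply: filterS => m; rewrite distrC.
exists m; split=> // y Dy.
have := mP (pi y); have := KP m _ _ (Dx _) Dy (xpi y Dy).
have := wyz _ _ (Dx _) Dy (xpi y Dy).
move: (K (Phi m) y) (K (Phi m) (x (pi y))) (w y) (w (x (pi y))) => a b a' b'.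
rewrite !ler_norml => /andP[? ?] /andP[? ?] /andP[? ?]; apply/andP; split; lra.
Qed.

End IntegralOperatorCompact.

(** * From the [L2] inequality back to point masses *)

Section Smoothing.
Context {d : measure_display} {T : measurableType d} {R : realType}.
Variables (rho : probability T R) (D : set T) (k : T -> T -> R).
Hypothesis mD : measurable D.
Hypothesis kpd : pos_def_kernel D k.
Hypothesis kfine : forall e : R, 0 < e -> fine_partition D (kclose D k e).

Local Notation L2 := (L2fun rho D).
Local Notation ip := (L2inner rho D).
Local Notation K := (intop rho D k).

Section Averages.
Variables (U : T -> set T).
Hypothesis mU : forall x, D x -> measurable (U x).
Hypothesis UD : forall x, D x -> U x `<=` D.
Hypothesis rhoU : forall x, D x -> (0 < rho (U x))%E.

Definition avg_density (x : T) : T -> R := (fine (rho (U x)))^-1 \*o \1_(U x).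

(* The point masses of [v] replaced by uniform densities on the sets [U x]. *)
Definition comb_density (v : seq (R * T)) : T -> R :=
  foldr (fun p f => (p.1 \*o avg_density p.2) \+ f) (cst 0) v.

Definition comb_abs (v : seq (R * T)) : R := \sum_(p <- v) `|p.1|.

Lemma comb_abs_ge0 v : 0 <= comb_abs v.
Proof. by apply: sumr_ge0. Qed.

Lemma fine_rhoU_gt0 x : D x -> 0 < fine (rho (U x)).
Proof.
move=> Dx; apply: fine_gt0; rewrite rhoU//=.
by rewrite (le_lt_trans (probability_le1 _ (mU Dx)))// ltry.
Qed.

Lemma L2_indic A : measurable A -> L2 (\1_A : T -> R).
Proof.
move=> mA; apply: (@L2_bounded _ _ _ _ _ mD 1); first exact: measurable_indic.
by move=> y _; rewrite indicE; case: (_ \in _); rewrite ?normr1 ?normr0.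
Qed.

Lemma L2_avg_density x : D x -> L2 (avg_density x).
Proof. by move=> Dx; apply: L2_scale => //; exact/L2_indic/mU. Qed.

Lemma L2_comb_density v : comb_pts D v -> L2 (comb_density v).
Proof.
elim: v => [_|p v IH [Dp Dv]] /=; first exact: L2_cst.
by apply: L2_add => //; [apply: L2_scale => //; exact: L2_avg_density|exact: IH].
Qed.

Lemma avg_densityP (e : R) (h : T -> R) x : L2 h -> D x ->
  (forall y, U x y -> `|h x - h y| <= e) -> `|ip (avg_density x) h - h x| <= e.
Proof.
move=> Lh Dx he; have r0 := fine_rhoU_gt0 Dx; set r := fine _ in r0.
have LU : L2 (\1_(U x) : T -> R) by exact/L2_indic/mU.
have I1 : ip (\1_(U x)) (cst 1) = r.
  rewrite /L2inner; under eq_Rintegral do rewrite /= mulr1.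
  rewrite /Rintegral integral_indic//; last exact: mU.
  by rewrite setIidl//; exact: UD.
rewrite L2innerZl// -/r.
(* The density has total mass one, so the constant [h x] can be moved under the integral. *)
have -> : r^-1 * ip (\1_(U x)) h - h x =
    r^-1 * ip (\1_(U x)) (h \- (h x \*o cst 1)).
  have Lc : L2 (h x \*o cst 1) by apply: L2_scale => //; exact: L2_cst.
  rewrite L2innerBr// L2innerZr//; last exact: L2_cst.
  by rewrite I1; field; rewrite gt_eqF.
rewrite normrM gtr0_norm ?invr_gt0// ler_pdivrMl// -I1 mulrC -L2innerZr//; last exact: L2_cst.
apply: normr_Rintegral_le => //.
- apply: (L2_mul mD) => //; apply: L2_sub => //; apply: L2_scale => //; exact: L2_cst.
- apply: (L2_mul mD) => //; apply: L2_scale => //; exact: L2_cst.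
- move=> y Dy; rewrite normrM /= !mulr1.
  have [yU|/negPf yU] := boolP (y \in U x).
    by rewrite indicE yU normr1 !mul1r distrC he//; exact/set_mem.
  by rewrite indicE yU normr0 !mul0r.
Qed.

Lemma comb_densityP (e : R) (h : T -> R) v : L2 h -> comb_pts D v ->
  (forall x y, D x -> U x y -> `|h x - h y| <= e) ->
  `|ip (comb_density v) h - comb_apply h v| <= e * comb_abs v.
Proof.
move=> Lh + he; rewrite /comb_abs /comb_apply.
elim: v => [_|p v IH /= [Dp Dv]].
  rewrite !big_nil subr0 mulr0 /= /L2inner; under eq_Rintegral do rewrite /= mul0r.
  by rewrite Rintegral_cst// mul0r normr0.
have La := L2_avg_density Dp; have Ls := L2_scale mD p.1 La.
rewrite !big_cons L2innerDl//; last exact: L2_comb_density.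
rewrite L2innerZl// opprD addrACA -mulrBr [leRHS]mulrDr.
rewrite (le_trans (ler_normD _ _))// lerD//; last exact: IH.
rewrite normrM mulrC ler_wpM2r//; apply: avg_densityP => // y; exact: he.
Qed.

End Averages.

Lemma comb_abs_le (h : T -> R) (e : R) v : comb_pts D v ->
  (forall x, D x -> `|h x| <= e) -> `|comb_apply h v| <= e * comb_abs v.
Proof.
move=> + he; rewrite /comb_abs /comb_apply.
elim: v => [_|p v IH /= [Dp Dv]]; first by rewrite !big_nil normr0 mulr0.
rewrite !big_cons mulrDr (le_trans (ler_normD _ _))// lerD//; last exact: IH.
by rewrite normrM mulrC ler_wpM2r// he.
Qed.

Lemma comb_applyB (h1 h2 : T -> R) v :
  comb_apply (h1 \- h2) v = comb_apply h1 v - comb_apply h2 v.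
Proof.
rewrite /comb_apply -sumrB; apply: eq_bigr => p _ /=; rewrite mulrBr//.
Qed.

Lemma L2_dominated (g : T -> R) (B : R) : L2 g ->
  (forall (x : T) (e : R), D x -> 0 < e -> exists U : set T,
     [/\ measurable U, U `<=` D, (0 < rho U)%E &
         forall y, U y -> kclose D k e x y /\ `|g x - g y| <= e]) ->
  (forall phi, L2 phi -> ip phi g ^+ 2 <= B ^+ 2 * ip phi (K phi)) ->
  dominated D k g B.
Proof.
move=> Lg supp gB v Dv; set q := comb_apply g v; set A := comb_abs v.
have A0 : 0 <= A by exact: comb_abs_ge0.
have B0 : 0 <= B ^+ 2 by exact: sqr_ge0.
rewrite -subr_le0.
apply: (@ler0_of_forall _ (2 * `|q| * A + B ^+ 2 * (4 * (A * A)))).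
  by apply: addr_ge0; apply: mulr_ge0 => //; rewrite !mulr_ge0.
move=> e e0.
have /choice[U UP] x : exists U : set T, D x -> [/\ measurable U, U `<=` D, (0 < rho U)%E &
    forall y, U y -> kclose D k e x y /\ `|g x - g y| <= e].
  have [Dx|nDx] := pselect (D x); last by exists set0.
  by have [U ?] := supp x e Dx e0; exists U.
have mU x : D x -> measurable (U x) by move=> /UP[].
have UD x : D x -> U x `<=` D by move=> /UP[].
have rU x : D x -> (0 < rho (U x))%E by move=> /UP[].
have kU x y : D x -> U x y -> kclose D k e x y by move=> /UP[_ _ _ h] /h[].
have gU x y : D x -> U x y -> `|g x - g y| <= e by move=> /UP[_ _ _ h] /h[].
pose phi := comb_density U v.
have Lphi : L2 phi by exact: L2_comb_density.
have h1 : `|ip phi g - q| <= e * A by exact: comb_densityP.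
(* On [D] this is the function represented by [v]. It is the bridge from [K phi], which is uniformly
   close to it, to [comb_norm2 k v], which equals [comb_apply c v]. *)
pose c y := comb_apply (k y) v.
have Kc y : D y -> `|K phi y - c y| <= e * A.
  move=> Dy; rewrite intopE L2innerC; apply: comb_densityP => //.
    exact: (L2_kernel _ mD kpd kfine).
  move=> x z Dx xz; rewrite (kpd.1 y x)// (kpd.1 y z)//; last exact: UD xz.
  exact: kU.
have cc x y : D x -> U x y -> `|c x - c y| <= e * A.
  move=> Dx xy; rewrite /c -comb_applyB; apply: comb_abs_le => // z Dz.
  exact: kU.
(* The oscillation of [K phi] on [U x] is at most [3 e A]: two comparisons with [c] and the
   oscillation of [c] itself. *)
have h2 : `|ip phi (K phi) - comb_apply (K phi) v| <= 3 * (e * A) * A.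
  apply: comb_densityP => //; first exact: (L2_intop mD kpd kfine).
  move=> x y Dx xy; have := Kc x Dx; have := Kc y (UD _ Dx _ xy); have := cc x y Dx xy.
  move: (K phi x) (K phi y) (c x) (c y) (e * A) => a b a' b' t.
  by rewrite !ler_norml => /andP[? ?] /andP[? ?] /andP[? ?]; apply/andP; split; lra.
have h3 : `|comb_apply (K phi) v - comb_norm2 k v| <= e * A * A.
  have -> : comb_norm2 k v = comb_apply c v.
    rewrite /comb_norm2 /comb_apply; apply: eq_bigr => p _.
    by rewrite mulr_sumr; apply: eq_bigr => p' _; rewrite mulrA.
  by rewrite -comb_applyB; apply: comb_abs_le.
have h4 := sqr_close_le h1; have h5 := gB _ Lphi.
have h6 : ip phi (K phi) <= comb_norm2 k v + 4 * (e * (A * A)).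
  move: h2 h3; move: (ip phi (K phi)) (comb_apply (K phi) v) (comb_norm2 k v) => a b b'.
  by rewrite !ler_norml => /andP[? ?] /andP[? ?]; lra.
have := ler_wpM2l B0 h6.
move: h4 h5; move: (ip phi (K phi)) (ip phi g ^+ 2) (comb_norm2 k v) (B ^+ 2) `|q| => a b b' B2 q'.
by move=> ? ? ?; lra.
Qed.

End Smoothing.

(** * Eigenfunction expansions and Rayleigh quotients *)

Section Spectral.
Context {d : measure_display} {T : measurableType d} {R : realType}.
Variables (rho : probability T R) (D : set T) (k : T -> T -> R).
Hypothesis mD : measurable D.
Hypothesis kpd : pos_def_kernel D k.
Hypothesis kfine : forall e : R, 0 < e -> fine_partition D (kclose D k e).

Local Notation L2 := (L2fun rho D).
Local Notation ip := (L2inner rho D).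
Local Notation K := (intop rho D k).
Local Notation L1norm := (L1norm rho D).

Variables (lambda : nat -> R) (psi : nat -> T -> R).
Hypothesis lambda_gt0 : forall i, 0 < lambda i.
Hypothesis lambdaS : forall i, lambda i.+1 <= lambda i.
Hypothesis Lpsi : forall i, L2 (psi i).
Hypothesis psi_ortho : forall i j, ip (psi i) (psi j) = (i == j)%:R.
Hypothesis psi_eigen : forall i, {ae rho, forall x, D x -> K (psi i) x = lambda i * psi i x}.
Hypothesis psi_complete : forall (l : R) (g : T -> R), 0 < l -> L2 g ->
  {ae rho, forall x, D x -> K g x = l * g x} ->
  L2dist2 rho D g (fun x => \sum_(i < n) ip g (psi i) * psi i x) @[n --> \oo] --> 0.

Let LK phi : L2 phi -> L2 (K phi).
Proof. exact: (L2_intop mD kpd kfine). Qed.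

Let Ksym phi1 phi2 : L2 phi1 -> L2 phi2 -> ip phi1 (K phi2) = ip phi2 (K phi1).
Proof. exact: (intop_sym mD kpd kfine). Qed.

Let Kge0 phi : L2 phi -> 0 <= ip phi (K phi).
Proof. exact: (intop_ge0 mD kpd kfine). Qed.

Lemma inner_eigen phi i : L2 phi -> ip phi (K (psi i)) = lambda i * ip phi (psi i).
Proof.
move=> Lphi; rewrite -(L2innerZr mD)// /L2inner /Rintegral; congr fine.
apply: ae_eq_integral => //.
- by apply/measurable_EFinP/measurable_funM; [exact: Lphi.1|exact: (LK (Lpsi i)).1].
- by apply/measurable_EFinP/measurable_funM; [exact: Lphi.1|exact: (L2_scale mD _ (Lpsi i)).1].
- by apply: filterS (psi_eigen i) => x h Dx /=; rewrite h.
Qed.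

Lemma lambda_le i j : (i <= j)%N -> lambda j <= lambda i.
Proof.
move=> /subnK <-; elim: (j - i)%N => [|n IH]; first by rewrite add0n.
by rewrite addSn (le_trans (lambdaS _)).
Qed.

Definition residue (n : nat) (g : T -> R) : T -> R :=
  g \- lincomb n (fun i => ip g (psi i)) psi.

Lemma L2_residue n g : L2 g -> L2 (residue n g).
Proof. by move=> Lg; apply: L2_sub => //; exact: L2_lincomb. Qed.

Lemma inner_lincomb_psi n c i : (i < n)%N -> ip (lincomb n c psi) (psi i) = c i.
Proof.
move=> iltn; rewrite L2inner_lincombl//.
rewrite (bigD1 (Ordinal iltn))//= psi_ortho eqxx mulr1 big1 ?addr0// => j ji.
rewrite psi_ortho (_ : (j == i :> nat) = false) ?mulr0//.
by apply/negbTE; move: ji; rewrite -val_eqE.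
Qed.

Lemma residue_ortho n g i : L2 g -> (i < n)%N -> ip (residue n g) (psi i) = 0.
Proof.
move=> Lg iltn; rewrite L2innerBl//; last exact: L2_lincomb.
by rewrite inner_lincomb_psi// subrr.
Qed.

Lemma inner_residue n g : L2 g ->
  ip (residue n g) (residue n g) = ip (residue n g) g.
Proof.
move=> Lg; have Lr := L2_residue n Lg; have Ls := L2_lincomb mD n (fun i => ip g (psi i)) Lpsi.
rewrite {2}/residue L2innerBr// (L2innerC _ _ _ (lincomb _ _ _)) L2inner_lincombl// big1 ?subr0// => i _.
by rewrite (L2innerC _ _ (psi i)) residue_ortho ?mulr0.
Qed.

Lemma bessel n g : L2 g -> \sum_(i < n) ip g (psi i) ^+ 2 <= ip g g.
Proof.
move=> Lg; have := L2inner_ge0 rho D (residue n g).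
rewrite inner_residue// L2innerBl//; last exact: L2_lincomb.
rewrite L2inner_lincombl// subr_ge0; congr (_ <= _).
by apply: eq_bigr => i _; rewrite (L2innerC _ _ (psi i)) expr2.
Qed.

(** Positivity of the form on the residue; mixed terms vanish because [K] multiplies each [psi i] by
    [lambda i], and the residue is orthogonal to it for [i < n]. *)
Lemma bessel_intop n phi : L2 phi ->
  \sum_(i < n) lambda i * ip phi (psi i) ^+ 2 <= ip phi (K phi).
Proof.
move=> Lphi; have Lr := L2_residue n Lphi.
have Ls := L2_lincomb mD n (fun i => ip phi (psi i)) Lpsi.
have := Kge0 Lr; rewrite {1}/residue L2innerBl//; last exact: LK.
rewrite (L2inner_lincombl mD _ _ Lpsi (LK Lr)) big1 ?subr0; last first.
  by move=> i _; rewrite Ksym// inner_eigen// residue_ortho ?mulr0// mulr0.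
rewrite Ksym// L2innerBl//; last exact: LK.
rewrite (L2inner_lincombl mD _ _ Lpsi (LK Lphi)) subr_ge0; congr (_ <= _).
apply: eq_bigr => i _; rewrite Ksym// inner_eigen//; ring.
Qed.

(** Hilbert-Schmidt bound: the coefficients of the section [k x] are [K (psi i) x], so Bessel's
    inequality for [k x], integrated over [x], sums the squares of the eigenvalues. *)
Lemma lambda_sqr_sum (M : R) : (forall x y, D x -> D y -> `|k x y| <= M) ->
  forall n, \sum_(i < n) lambda i ^+ 2 <= M ^+ 2.
Proof.
move=> kM n.
have -> : \sum_(i < n) lambda i ^+ 2 = \sum_(i < n) ip (K (psi i)) (K (psi i)).
  apply: eq_bigr => i _; rewrite inner_eigen; last exact: LK.
  by rewrite L2innerC inner_eigen// psi_ortho eqxx mulr1.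
have iKK (i : 'I_n) : rho.-integrable D (EFin \o (fun x => K (psi i) x * K (psi i) x)).
  by apply: (L2_mul mD); exact: LK.
rewrite -(Rintegral_bigsum mD _ iKK).
apply: (@le_trans _ _ (\int[rho]_(x in D) M ^+ 2)); last first.
  rewrite Rintegral_cst// ler_piMr ?sqr_ge0// -lee_fin fineK ?probability_le1//.
  by rewrite ge0_fin_numE// prob_lt_pinfty.
apply: le_Rintegral => //.
- exact: integrable_bigsum.
- by apply: (L2_integrable mD (f := cst (M ^+ 2))); exact: L2_cst.
- move=> x Dx; have Lk : L2 (k x) by exact: (L2_kernel _ mD kpd kfine).
  apply: (le_trans _ (le_trans (bessel n Lk) _)).
    by apply: ler_sum => i _; rewrite expr2.
  apply: (le_trans (ler_norm _)).
  apply: (le_trans (L2inner_bounded mD Lk Lk (fun y Dy => kM x y Dx Dy))).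
  have M0 : 0 <= M := le_trans (normr_ge0 _) (kM x x Dx Dx).
  rewrite expr2 ler_wpM2l// /L1norm.
  apply: (@le_trans _ _ (\int[rho]_(x in D) M)).
    apply: le_Rintegral => //; first by apply: integrable_norm; exact: L2_integrable.
      by apply: (L2_integrable mD (f := cst M)); exact: L2_cst.
    by move=> y Dy; exact: kM.
  rewrite Rintegral_cst// ler_piMr// -lee_fin fineK ?probability_le1//.
  by rewrite ge0_fin_numE// prob_lt_pinfty.
Qed.

(** By monotonicity [(n + 1) lambda_n^2] is at most the sum of the first [n + 1] squares. *)
Lemma lambda_cvg0 : lambda n @[n --> \oo] --> 0.
Proof.
have [M [M0 kM]] := kernel_bounded kpd kfine.
have ln n : lambda n ^+ 2 * n.+1%:R <= M ^+ 2.
  apply: le_trans (lambda_sqr_sum kM n.+1).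
  have -> : lambda n ^+ 2 * n.+1%:R = \sum_(i < n.+1) lambda n ^+ 2.
    by rewrite sumr_const card_ord mulr_natr.
  apply: ler_sum => i _; rewrite ler_pXn2r ?nnegrE//; [|exact: ltW..].
  by rewrite lambda_le// -ltnS.
apply/cvgrPdist_le => e e0.
have t0 : 0 < e ^+ 2 / M ^+ 2 by rewrite divr_gt0 ?exprn_gt0.
move/cvgrPdist_le : (@cvg_harmonic R) => /(_ _ t0); apply: filterS => n.
rewrite !sub0r !normrN !gtr0_norm ?invr_gt0// => hn.
rewrite -(ler_pXn2r (ltn0Sn 1)) ?nnegrE//; [|exact: ltW..].
have := ln n; rewrite -ler_pdivlMr// => /le_trans; apply.
by rewrite mulrC -ler_pdivlMr ?exprn_gt0.
Qed.

Section Maximiser.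
Variable n : nat.

Definition orth phi : Prop := L2 phi /\ forall i, (i < n)%N -> ip phi (psi i) = 0.

Lemma orth_intop phi : orth phi -> orth (K phi).
Proof.
move=> [Lphi phi0]; split; first exact: LK.
by move=> i iltn; rewrite L2innerC Ksym// inner_eigen// phi0// mulr0.
Qed.

Lemma orth_scale c phi : orth phi -> orth (c \*o phi).
Proof.
move=> [Lphi phi0]; split; first exact: L2_scale.
by move=> i iltn; rewrite L2innerZl// phi0// mulr0.
Qed.

Lemma inner_scale_intop c phi : L2 phi ->
  ip (c \*o phi) (K (c \*o phi)) = c ^+ 2 * ip phi (K phi).
Proof.
move=> Lphi; have Lc := L2_scale mD c Lphi.
rewrite (L2innerZl mD c Lphi (LK Lc)) (Ksym Lphi Lc) (L2innerZl mD c Lphi (LK Lphi)).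
by rewrite mulrA -expr2.
Qed.

Variable nu : R.
Hypothesis nu_gt0 : 0 < nu.
Hypothesis nu_ub : forall phi, orth phi -> ip phi phi <= 1 -> ip phi (K phi) <= nu.
Hypothesis nu_sup : forall e : R, 0 < e ->
  exists phi, [/\ orth phi, ip phi phi <= 1 & nu - e <= ip phi (K phi)].

Lemma rayleigh phi : orth phi -> ip phi (K phi) <= nu * ip phi phi.
Proof.
move=> Mphi; have [Lphi phi0] := Mphi.
have [z|z] := eqVneq (ip phi phi) 0.
  have := L2_CauchySchwarz mD Lphi (LK Lphi); rewrite z mul0r mulr0 => h.
  have : ip phi (K phi) ^+ 2 = 0 by apply/eqP; rewrite eq_le h sqr_ge0.
  by move=> /eqP; rewrite sqrf_eq0 => /eqP ->.
have p0 : 0 < ip phi phi by rewrite lt0r z L2inner_ge0.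
pose c := (Num.sqrt (ip phi phi))^-1.
have c2 : c ^+ 2 = (ip phi phi)^-1 by rewrite /c exprVn sqr_sqrtr// ltW.
have := @nu_ub (c \*o phi) (orth_scale c Mphi).
rewrite inner_scale_intop// c2 L2innerZl//; last exact: L2_scale.
rewrite L2innerZr// mulrA -expr2 c2 mulVf// lexx => /(_ isT).
by rewrite ler_pdivrMl// mulrC.
Qed.

(** Cauchy-Schwarz for the form of [K], applied to [K phi] and [phi], followed by [rayleigh] at
    [K phi]; one factor [ip (K phi) (K phi)] cancels. *)
Lemma intop_sqr_le phi : orth phi -> ip (K phi) (K phi) <= nu * ip phi (K phi).
Proof.
move=> Mphi; have Lphi := Mphi.1; have LKp := LK Lphi.
have := intop_CauchySchwarz mD kpd kfine LKp Lphi.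
have := rayleigh (orth_intop Mphi); have := Kge0 Lphi; have := L2inner_ge0 rho D (K phi).
move: (ip (K phi) (K phi)) (ip phi (K phi)) (ip (K phi) (K (K phi))) => a b c a0 b0 ca h.
have [->|an] := eqVneq a 0; first by rewrite mulr_ge0// ltW.
have a0' : 0 < a by rewrite lt0r an.
rewrite -(ler_pM2l a0') -expr2 (le_trans h)// mulrA (mulrC a).
by rewrite ler_wpM2r.
Qed.

(** Expanding the square, [intop_sqr_le] and [ip phi phi <= 1] leave [nu * (nu - ip phi (K phi))]:
    near-maximisers are approximate eigenfunctions. *)
Lemma maximiser_approx phi (e : R) : orth phi -> ip phi phi <= 1 ->
  nu - e <= ip phi (K phi) -> ip (K phi \- (nu \*o phi)) (K phi \- (nu \*o phi)) <= nu * e.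
Proof.
move=> Mphi phi1 he; have Lphi := Mphi.1; have LKp := LK Lphi; have Ls := L2_scale mD nu Lphi.
have LB := L2_sub mD LKp Ls.
rewrite L2innerBl// !L2innerBr// !(L2innerZl mD nu Lphi) // !(L2innerZr mD nu Lphi)//.
rewrite (L2innerC _ _ (K phi) phi).
have := intop_sqr_le Mphi; move: (ip (K phi) _) (ip phi (K phi)) (ip phi phi) phi1 he.
move=> a b c c1 he ab.
have : nu * (nu * c) <= nu * nu by rewrite ler_pM2l// ler_piMr// ltW.
have : nu * (nu - e) <= nu * b by rewrite ler_pM2l.
lra.
Qed.

(** The candidate is a uniform limit of images [K phi] of near-maximisers. The equation then holds
    at every point of [D], because [K] turns [L2]-small errors into uniformly small ones. *)
Lemma eigenfunction_exists : exists w, [/\ orth w, 0 < ip w w &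
  forall x, D x -> K w x = nu * w x].
Proof.
have /choice[Phi PhiP] (m : nat) : exists phi, [/\ orth phi, ip phi phi <= 1 &
    nu - m.+1%:R^-1 <= ip phi (K phi)] by apply: nu_sup; rewrite invr_gt0.
have LPhi m : L2 (Phi m) by case: (PhiP m) => -[].
have Phi1 m : ip (Phi m) (Phi m) <= 1 by case: (PhiP m).
have [w wP0] := intop_compact mD kpd kfine LPhi Phi1.
have wP (e : R) : 0 < e -> exists phi, [/\ orth phi, ip phi phi <= 1,
    nu - e <= ip phi (K phi) & forall x, D x -> `|K phi x - w x| <= e].
  move=> e0; have [m0 m0e] : exists m0 : nat, m0.+1%:R^-1 <= e :> R.
    have /cvgrPdist_le/(_ _ e0)/filter_ex[m0] := @cvg_harmonic R.
    rewrite sub0r normrN => h; exists m0.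
    exact: le_trans (ler_norm _) h.
  have [m [mm0 mw]] := wP0 e m0 e0; have [Mm m1 mnu] := PhiP m.
  exists (Phi m); split => //; apply: le_trans mnu; rewrite lerD2l lerN2.
  by apply: le_trans m0e; rewrite lef_pV2 ?posrE// ler_nat.
have wu : uosc D w.
  apply: uosc_uniform_limit => e e0; have [phi [[Lphi _] _ _ phiw]] := wP e e0.
  by exists (K phi); split => //; exact: (intop_uosc mD kpd kfine).
have Lw : L2 w by exact: (L2_uosc rho mD).
have [M [M0 kM]] := kernel_bounded kpd kfine.
have Mw : orth w.
  split=> // i iltn; apply/eqP; rewrite -normr_le0.
  apply: (ler0_of_forall (L1norm_ge0 rho D (psi i))) => e e0.
  have [phi [Mphi _ _ phiw]] := wP e e0; have LKp := LK Mphi.1.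
  have -> : ip w (psi i) = ip (w \- K phi) (psi i).
    by rewrite L2innerBl// (orth_intop Mphi).2// subr0.
  apply: (L2inner_bounded mD) => //; first exact: L2_sub.
  by move=> x Dx; rewrite /= distrC phiw.
(* If [w] were null, [ip phi (K phi)] would be at most [e] while being at least [nu - e], for every
   [e]. *)
have w0 : 0 < ip w w.
  rewrite lt0r L2inner_ge0 andbT; apply/negP => /eqP ww0.
  suff : nu <= 0 by rewrite leNgt nu_gt0.
  apply: (@ler0_of_forall _ 2) => // e e0.
  have [phi [Mphi phi1 he phiw]] := wP e e0; have Lphi := Mphi.1; have LKp := LK Lphi.
  have pw : ip phi w = 0.
    have := L2_CauchySchwarz mD Lphi Lw; rewrite ww0 mulr0 => h.
    have : ip phi w ^+ 2 = 0 by apply/eqP; rewrite eq_le h sqr_ge0.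
    by move=> /eqP; rewrite sqrf_eq0 => /eqP.
  have : ip phi (K phi) <= e.
    have -> : ip phi (K phi) = ip (K phi \- w) phi.
      by rewrite L2innerBl// (L2innerC _ _ w) pw subr0 L2innerC.
    apply: (le_trans (ler_norm _)).
    apply: (le_trans (L2inner_bounded mD (e := e) _ _ _)) => //; first exact: L2_sub.
    by rewrite ler_piMr//; [exact: ltW|exact: (L1norm_le1 mD)].
  move: he; lra.
exists w; split=> // x Dx.
apply/eqP; rewrite -subr_eq0 -normr_le0 leNgt; apply/negP => z0.
set z := `|_| in z0.
(* [e] is chosen so that the three error terms below add up to less than [z]. *)
pose t := z / (4 * (M + nu + 1)).
have Mn : 0 < M + nu + 1 by rewrite !addr_gt0.
have t0 : 0 < t by rewrite divr_gt0// mulr_gt0.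
pose e := Num.min t (t ^+ 2 / nu).
have e0 : 0 < e by rewrite lt_min t0 divr_gt0 ?exprn_gt0.
have [phi [Mphi phi1 he phiw]] := wP e e0; have Lphi := Mphi.1; have LKp := LK Lphi.
have Lnu := L2_scale mD nu Lphi.
have Lk : L2 (k x) by exact: (L2_kernel _ mD kpd kfine).
have b1 : `|K (w \- K phi) x| <= M * e.
  have LB := L2_sub mD Lw LKp.
  rewrite intopE L2innerC (le_trans (L2inner_bounded mD (e := e) LB Lk _))//.
    by move=> y Dy; rewrite /= distrC phiw.
  rewrite mulrC ler_wpM2r//; first exact: ltW.
  rewrite /L1norm.
  apply: (@le_trans _ _ (\int[rho]_(x in D) M)).
    apply: le_Rintegral => //; first by apply: integrable_norm; exact: L2_integrable.
      by apply: (L2_integrable mD (f := cst M)); exact: L2_cst.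
    by move=> y Dy; exact: kM.
  rewrite Rintegral_cst// ler_piMr//; first exact: ltW.
  rewrite -lee_fin fineK ?probability_le1//.
  by rewrite ge0_fin_numE// prob_lt_pinfty.
have b2 : `|K (K phi \- (nu \*o phi)) x| <= M * t.
  have LB := L2_sub mD LKp Lnu.
  apply: (le_trans (intop_bounded mD kpd kfine kM LB Dx)); rewrite ler_pM2l//.
  rewrite -(ler_pXn2r (ltn0Sn 1)) ?nnegrE ?L1norm_ge0//; last exact: ltW.
  apply: (le_trans (L1norm_sqr_le mD LB)); apply: (le_trans (maximiser_approx Mphi phi1 he)).
  by rewrite mulrC -ler_pdivlMr// /e ge_min lexx orbT.
have b3 : `|nu * (K phi x - w x)| <= nu * e by rewrite normrM gtr0_norm// ler_pM2l// phiw.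
have et : e <= t by rewrite /e ge_min lexx.
have zE : K w x - nu * w x = K (w \- K phi) x + K (K phi \- (nu \*o phi)) x
    + nu * (K phi x - w x).
  rewrite !intopE !L2innerBr// L2innerZr//; ring.
have : z <= 2 * (M + nu) * t.
  rewrite /z zE (le_trans (ler_normD _ _))//.
  have Me : M * e <= M * t by rewrite ler_pM2l.
  have Ne : nu * e <= nu * t by rewrite ler_pM2l.
  have Nt : 0 < nu * t by rewrite mulr_gt0.
  apply: (@le_trans _ _ (M * e + M * t + nu * e)); last by lra.
  by rewrite lerD// (le_trans (ler_normD _ _))// lerD.
rewrite leNgt => /negP; apply.
have -> : z = 4 * (M + nu + 1) * t by rewrite /t; field; rewrite gt_eqF.
rewrite ltr_pM2r//; lra.
Qed.

End Maximiser.

(* The maximum of the Rayleigh quotient on the complement of the first [n]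
   eigenfunctions is an eigenvalue, hence one of the [lambda i] with [i >= n]. *)
Lemma rayleigh_orth n phi : orth n phi -> ip phi (K phi) <= lambda n * ip phi phi.
Proof.
move=> Mphi; have [M [M0 kM]] := kernel_bounded kpd kfine.
pose E := [set ip f (K f) | f in [set f | orth n f /\ ip f f <= 1]].
have L0 : L2 (cst 0) by exact: L2_cst.
have ip0 f : ip (cst 0) f = 0.
  rewrite /L2inner; under eq_Rintegral do rewrite /= mul0r.
  by rewrite Rintegral_cst// mul0r.
have E0 : E 0.
  exists (cst 0) => //; split; last by rewrite ip0.
  by split=> // i _; rewrite ip0.
have EM : has_ubound E.
  exists M => _ [f [[Lf _] f1] <-]; apply: (le_trans (ler_norm _)).
  have fL1 := L1norm_le1 mD Lf f1.
  rewrite L2innerC (le_trans (L2inner_bounded mD (e := M) (LK Lf) Lf _))//.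
    move=> x Dx; rewrite (le_trans (intop_bounded mD kpd kfine kM Lf Dx))//.
    by rewrite ler_piMr// ltW.
  by rewrite ler_piMr// ltW.
have hE : has_sup E by split; [exists 0|].
pose nu := sup E.
have nu_ub f : orth n f -> ip f f <= 1 -> ip f (K f) <= nu.
  by move=> Mf f1; apply: sup_upper_bound => //; exists f.
have nu0 : 0 <= nu by exact: sup_upper_bound.
(* An eigenfunction is available only for [0 < nu]. When [nu = 0], the form is at most 0 on the
   complement and positivity of [lambda n] suffices. *)
have [nu0'|] := eqVneq nu 0.
  have [f1|f1] := leP (ip phi phi) 0.
    have p0 : ip phi phi = 0 by apply/eqP; rewrite eq_le f1 L2inner_ge0.
    by rewrite p0 mulr0 -nu0'; apply: nu_ub => //; rewrite p0.
  pose c := (Num.sqrt (ip phi phi))^-1.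
  have c2 : c ^+ 2 = (ip phi phi)^-1 by rewrite /c exprVn sqr_sqrtr// ltW.
  have := nu_ub (c \*o phi) (orth_scale c Mphi); have Lphi := Mphi.1.
  rewrite inner_scale_intop// c2 L2innerZl//; last exact: L2_scale.
  rewrite L2innerZr// mulrA -expr2 c2 mulVf ?gt_eqF// lexx => /(_ isT).
  rewrite ler_pdivrMl// nu0' mulr0 => /le_trans; apply.
  by rewrite mulr_ge0// ltW.
move=> nun0; have nu_gt0 : 0 < nu by rewrite lt0r nun0.
have nu_sup (e : R) : 0 < e -> exists f, [/\ orth n f, ip f f <= 1 & nu - e <= ip f (K f)].
  move=> e0; have [_ [f [Mf f1] <-] fe] := sup_adherent e0 hE.
  by exists f; split=> //; exact: ltW.
have [w [Mw w0 Kw]] := eigenfunction_exists nu_gt0 nu_ub nu_sup.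
apply: (le_trans (rayleigh nu_ub Mphi)); rewrite ler_wpM2r ?L2inner_ge0//.
have Lw := Mw.1.
(* If all coefficients vanished, completeness would make the constant [ip w w] tend to 0. *)
have [i iw] : exists i, ip w (psi i) != 0.
  apply/not_existsP => h; have {}h i : ip w (psi i) = 0 by apply/eqP/negPn/negP.
  have := psi_complete nu_gt0 Lw (aeW _ Kw).
  have -> : (fun m => L2dist2 rho D w (fun x => \sum_(i < m) ip w (psi i) * psi i x)) =
      (fun=> ip w w).
    apply/funext => m; apply: eq_Rintegral => x _.
    by rewrite big1 ?subr0 ?expr2// => j _; rewrite h mul0r.
  move=> /cvg_lim; rewrite lim_cst// => /(_ (@norm_hausdorff _ _)) w00.
  by move: w0; rewrite w00 ltxx.
have ni : (n <= i)%N by rewrite leqNgt; apply/negP => /Mw.2 z; rewrite z eqxx in iw.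
(* Symmetry computes [ip (K w) (psi i)] both as [nu] and as [lambda i] times the nonzero
   [ip w (psi i)]. *)
suff -> : nu = lambda i by exact: lambda_le.
apply: (mulIf iw); rewrite -inner_eigen// Ksym//.
rewrite -(L2innerZl mD)// L2innerC; apply: eq_Rintegral => x; rewrite inE => Dx.
by rewrite Kw// mulrC.
Qed.

Lemma residue_cvg0 (g : T -> R) (B : R) : L2 g ->
  (forall phi, L2 phi -> ip phi g ^+ 2 <= B ^+ 2 * ip phi (K phi)) ->
  ip (residue n g) (residue n g) @[n --> \oo] --> 0.
Proof.
move=> Lg gB.
have h n : ip (residue n g) (residue n g) <= B ^+ 2 * lambda n.
  have Lr := L2_residue n Lg.
  have Mr : orth n (residue n g) by split=> // i; exact: residue_ortho.
  have := rayleigh_orth Mr; have := gB _ Lr; rewrite -inner_residue//.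
  have := L2inner_ge0 rho D (residue n g).
  move: (ip _ _) (ip _ (K _)) => a b a0 ab bl.
  have [->|an] := eqVneq a 0; first by rewrite mulr_ge0 ?sqr_ge0// ltW.
  have a0' : 0 < a by rewrite lt0r an.
  have := ler_wpM2l (sqr_ge0 B) bl; rewrite mulrA => /(le_trans ab).
  by rewrite expr2 ler_pM2r.
apply: (@squeeze_cvgr _ _ _ _ (cst 0) (fun n => B ^+ 2 * lambda n)).
- by apply: nearW => n; rewrite L2inner_ge0 h.
- exact: cvg_cst.
- by rewrite -[X in _ --> X](mulr0 (B ^+ 2)); apply: cvgMr; exact: lambda_cvg0.
Qed.

Lemma coef_sum_le (g : T -> R) (B : R) n : L2 g ->
  (forall phi, L2 phi -> ip phi g ^+ 2 <= B ^+ 2 * ip phi (K phi)) ->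
  \sum_(i < n) ip g (psi i) ^+ 2 / lambda i <= B ^+ 2.
Proof.
move=> Lg gB; pose phi := lincomb n (fun i => ip g (psi i) / lambda i) psi.
have Lphi : L2 phi by exact: L2_lincomb.
set s := \sum_(i < n) _.
have s0 : 0 <= s by apply: sumr_ge0 => i _; rewrite divr_ge0 ?sqr_ge0// ltW.
have pg : ip phi g = s.
  rewrite L2inner_lincombl//; apply: eq_bigr => i _.
  by rewrite (L2innerC _ _ (psi i)) expr2 mulrAC.
have pK : ip phi (K phi) = s.
  rewrite (L2inner_lincombl mD _ _ Lpsi (LK Lphi)); apply: eq_bigr => i _.
  rewrite Ksym// inner_eigen// inner_lincomb_psi//.
  by field; rewrite gt_eqF.
have := gB _ Lphi; rewrite pg pK.
have [->|sn] := eqVneq s 0; first by rewrite sqr_ge0.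
by rewrite expr2 ler_pM2r// lt0r sn.
Qed.

Lemma series_dominates (g : T -> R) (c : nat -> R) (B : R) : L2 g ->
  L2dist2 rho D g (fun x => \sum_(i < n) c i * psi i x) @[n --> \oo] --> 0 ->
  (forall n, \sum_(i < n) c i ^+ 2 / lambda i <= B ^+ 2) ->
  forall phi, L2 phi -> ip phi g ^+ 2 <= B ^+ 2 * ip phi (K phi).
Proof.
move=> Lg gc cB phi Lphi.
have Ls n := L2_lincomb mD n c Lpsi.
have sP n : ip phi (lincomb n c psi) ^+ 2 <= B ^+ 2 * ip phi (K phi).
  rewrite L2innerC L2inner_lincombl//.
  apply: (@le_trans _ _ ((\sum_(i < n) c i ^+ 2 / lambda i) *
      (\sum_(i < n) lambda i * ip phi (psi i) ^+ 2))); last first.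
    apply: ler_pM => //; last exact: bessel_intop.
      by apply: sumr_ge0 => i _; rewrite divr_ge0 ?sqr_ge0// ltW.
    by apply: sumr_ge0 => i _; rewrite mulr_ge0 ?sqr_ge0// ltW.
  (* Weighted Cauchy-Schwarz: the quadratic in [t] is the sum of [(c i + t lambda_i <phi, psi_i>)^2
     / lambda_i]. *)
  apply: discriminant_le.
    by apply: sumr_ge0 => i _; rewrite mulr_ge0 ?sqr_ge0// ltW.
  move=> t; rewrite !mulr_sumr -!big_split/=; apply: sumr_ge0 => i _.
  have l0 := lambda_gt0 i; rewrite (L2innerC _ _ (psi i)).
  have -> : c i ^+ 2 / lambda i + 2 * t * (c i * ip phi (psi i)) +
      t ^+ 2 * (lambda i * ip phi (psi i) ^+ 2) =
      (c i + t * lambda i * ip phi (psi i)) ^+ 2 / lambda i by field; rewrite gt_eqF.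
  by rewrite divr_ge0 ?sqr_ge0// ltW.
have cv : ip phi (lincomb n c psi) @[n --> \oo] --> ip phi g.
  apply/cvgrPdist_le => e e0.
  have t0 : 0 < e ^+ 2 / (1 + ip phi phi) by rewrite divr_gt0 ?exprn_gt0// ltr_pwDl// L2inner_ge0.
  move/cvgrPdist_le : gc => /(_ _ t0); apply: filterS => n.
  rewrite sub0r normrN => /(le_trans (ler_norm _)).
  have LB := L2_sub mD Lg (Ls n).
  rewrite -[L2dist2 _ _ _ _]/(L2dist2 rho D g (lincomb n c psi)) L2dist2E => h.
  rewrite -(L2innerBr mD)// -(ler_pXn2r (ltn0Sn 1)) ?nnegrE//; last exact: ltW.
  rewrite real_normK ?num_real// (le_trans (L2_CauchySchwarz mD Lphi LB))//.
  rewrite ler_pdivlMr ?ltr_pwDl ?L2inner_ge0// in h.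
  apply: le_trans h; rewrite mulrC ler_wpM2l ?L2inner_ge0//.
  by rewrite lerDr.
have cv2 : ip phi (lincomb n c psi) ^+ 2 @[n --> \oo] --> ip phi g ^+ 2.
  by rewrite expr2; under eq_fun do rewrite expr2; exact: cvgM.
by apply: (cvgr_to_le cv2); apply: nearW => n; exact: sP.
Qed.

End Spectral.

(** * Fine partitions of compact sets *)

Lemma finite_cover_fine_partition {d} {T : measurableType d} (D : set T)
    (rel : T -> T -> Prop) N (x : 'I_N.+1 -> T) (V : 'I_N.+1 -> set T) :
  measurable D -> (forall i, D (x i)) -> (forall i, measurable (V i)) ->
  (forall y, D y -> exists i, V i y) ->
  (forall i y, D y -> V i y -> rel (x i) y) -> fine_partition D rel.
Proof.
move=> mD Dx mV DV xV.
(* [b y] records which sets of the cover contain [y]. The cell of [y] depends on this pattern alone,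
   so a cell is a finite union of finite intersections of the [V j] and their complements; the
   default [ord0] is never reached on [D]. *)
pose b y : {ffun 'I_N.+1 -> bool} := [ffun i => `[< V i y >]].
pose F (c : {ffun 'I_N.+1 -> bool}) := odflt ord0 [pick i | c i].
exists N, x, (fun y => F (b y)); split=> // [i|y Dy].
  apply: measurableI => //.
  have -> : (fun y => F (b y)) @^-1` [set i] =
      \bigcup_(c in [set c | F c = i]) \bigcap_(j in setT)
        (if c j then V j else ~` V j).
    apply/seteqP; split=> y /=.
      move=> Fi; exists (b y) => // j _; rewrite ffunE.
      by case: asboolP.
    move=> [c /= <- cV]; congr F; apply/ffunP => j; rewrite ffunE.
    by have := cV j I; case: (c j) => h; [exact/asboolT|exact/asboolF].
  apply: fin_bigcup_measurable => [|c _]; first exact: finite_finset.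
  apply: fin_bigcap_measurable => [|j _]; first exact: finite_finset.
  by case: (c j) => //; exact: measurableC.
apply: xV => //; rewrite /F; case: pickP => [i /=|/= h].
  by rewrite ffunE => /asboolP.
by have [i Vi] := DV y Dy; have := h i; rewrite ffunE (asboolT Vi).
Qed.

Lemma compact_finite_centers (T : topologicalType) (D : set T) (V : T -> set T) :
  compact D -> D !=set0 -> (forall x, D x -> open (V x)) ->
  (forall x, D x -> V x x) ->
  exists N (x : 'I_N.+1 -> T), (forall i, D (x i)) /\
    forall y, D y -> exists i, V (x i) y.
Proof.
move=> cD [x0 Dx0] oV Vx; apply: contrapT => nofin.
(* Without a finite cover, the uncovered remainders [B s] generate a proper filter on [D]. A cluster
   point [y] would have to meet [B [:: y]] inside [V y]. *)
pose B (s : seq T) : set T := [set y | D y /\ forall x, x \in s -> ~ V x y].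
pose G := filter_from [set s : seq T | forall x, x \in s -> D x] B.
have B0 s : (forall x, x \in s -> D x) -> B s !=set0.
  move=> sD; apply: contrapT => Bs0; apply: nofin.
  (* Prepending [x0] accounts for the [.+1] in the index type, so an empty [s] is allowed. *)
  exists (size s), (fun i => nth x0 (x0 :: s) i); split.
    by move=> [[|i] /= ilt]//; apply: sD; exact: mem_nth.
  move=> y Dy; apply: contrapT => nV; apply: Bs0; exists y; split=> // x xs Vxy.
  apply: nV; have ilt : ((index x s).+1 < (size s).+1)%N by rewrite ltnS index_mem.
  by exists (Ordinal ilt); rewrite /= nth_index.
have GP : ProperFilter G.
  apply: filter_from_proper => //; apply: filter_from_filter; first by exists [::].
  move=> s t sD tD; exists (s ++ t).
    by move=> x; rewrite mem_cat => /orP[/sD|/tD].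
  by move=> y [Dy h]; split; split=> // x xst; apply: h; rewrite mem_cat xst ?orbT.
have [|y [Dy cy]] := cD G GP; first by exists [::] => // y [].
have [] := cy (B [:: y]) (V y).
- by exists [:: y] => // x; rewrite inE => /eqP ->.
- by apply: open_nbhs_nbhs; split; [exact: oV|exact: Vx].
- by move=> z [[_ h] Vz]; apply: (h y) => //; rewrite inE.
Qed.

Section LocalToFine.
Context {R : realType}.

Lemma open_measurable_rV n (U : set 'rV[R]_n) : open U -> measurable U.
Proof. by move=> oU; exact: sub_gen_smallest. Qed.

Lemma compact_measurable_rV n (U : set 'rV[R]_n) : compact U -> measurable U.
Proof.
move=> cU; rewrite -(setCK U); apply: measurableC; apply: open_measurable_rV.
by apply: closed_openC; apply: compact_closed => //; exact: norm_hausdorff.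
Qed.

(** The centres of the finite subcover become the tags, so [rel] is needed only from a centre to its
    neighbours and may be any relation. *)
Lemma fine_partition_rV n (D : set 'rV[R]_n) (rel : 'rV[R]_n -> 'rV[R]_n -> Prop) :
  compact D -> D !=set0 ->
  (forall x, D x -> \forall y \near x, D y -> rel x y) -> fine_partition D rel.
Proof.
move=> cD D0 loc.
have /choice[r rP] x : exists r : R, 0 < r /\ (D x -> forall y, ball x r y -> D y -> rel x y).
  have [Dx|nDx] := pselect (D x); last by exists 1.
  by have /nbhs_ballP[r r0 h] := loc x Dx; exists r; split=> // _ y /h.
have [|x Dx|N [x [Dx cov]]] := compact_finite_centers (V := fun x : 'rV[R]_n => ball x (r x)) cD D0.
- by move=> x _; exact: ball_open.
- by apply: ballxx; case: (rP x).
apply: (finite_cover_fine_partition (x := x) (V := fun i => ball (x i) (r (x i)))) => //.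
- exact: compact_measurable_rV.
- by move=> i; apply: open_measurable_rV; exact: ball_open.
- by move=> i y Dy xy; apply: (rP (x i)).2.
Qed.

Lemma ball_prod_measurable n m (x : 'rV[R]_n * 'rV[R]_m) (r : R) : measurable (ball x r).
Proof.
have -> : ball x r = ball x.1 r `*` ball x.2 r by [].
by apply: measurableX; apply: open_measurable_rV; exact: ball_open.
Qed.

Lemma fine_partition_prod n m (D : set ('rV[R]_n * 'rV[R]_m)) rel :
  measurable D -> compact D -> D !=set0 ->
  (forall x, D x -> \forall y \near x, D y -> rel x y) -> fine_partition D rel.
Proof.
move=> mD cD D0 loc.
have /choice[r rP] x : exists r : R, 0 < r /\ (D x -> forall y, ball x r y -> D y -> rel x y).
  have [Dx|nDx] := pselect (D x); last by exists 1.
  by have /nbhs_ballP[r r0 h] := loc x Dx; exists r; split=> // _ y /h.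
have [|x Dx|N [x [Dx cov]]] := compact_finite_centers (V := fun x : 'rV[R]_n * 'rV[R]_m => ball x (r x)) cD D0.
- by move=> x _; exact: ball_open.
- by apply: ballxx; case: (rP x).
apply: (finite_cover_fine_partition (x := x) (V := fun i => ball (x i) (r (x i)))) => //.
- by move=> i; exact: ball_prod_measurable.
- by move=> i y Dy xy; apply: (rP (x i)).2.
Qed.

Lemma within_continuous_near (T : topologicalType) (D : set T) (f : T -> R) x (e : R) :
  {within D, continuous f} -> D x -> 0 < e ->
  \forall y \near x, D y -> `|f x - f y| <= e.
Proof.
move=> /subspace_continuousP/(_ x) cf Dx e0.
by have /cvgrPdist_le/(_ e e0) := cf Dx.
Qed.

(* The tube lemma for the continuous function [(x, z) |-> k x z]. *)
Lemma kclose_near (T : topologicalType) (D : set T) (k : T -> T -> R) x (e : R) :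
  compact D -> {within D `*` D, continuous (fun q => k q.1 q.2)} -> D x -> 0 < e ->
  \forall y \near x, D y -> forall z, D z -> `|k x z - k y z| <= e.
Proof.
move=> cD ck Dx e0; have e2 : 0 < e / 2 by rewrite divr_gt0.
have loc z : D z -> exists UV : set T * set T, [/\ nbhs x UV.1, open UV.2, UV.2 z &
    forall y z', D y -> D z' -> UV.1 y -> UV.2 z' -> `|k x z - k y z'| <= e / 2].
  move=> Dz.
  have := within_continuous_near (D := D `*` D) (x := (x, z)) ck (conj Dx Dz) e2.
  move=> [[U V] /= [xU zV] UV].
  move: zV; rewrite nbhsE => -[W [oW Wz] WV].
  exists (U, W); split=> //= y z' Dy Dz' Uy Wz'.
  by apply: (UV (y, z')) => //; split=> //; exact: WV.
have /choice[UV UVP] z : exists UV : set T * set T, D z -> [/\ nbhs x UV.1, open UV.2, UV.2 z &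
    forall y z', D y -> D z' -> UV.1 y -> UV.2 z' -> `|k x z - k y z'| <= e / 2].
  have [Dz|nDz] := pselect (D z); last by exists (set0, set0).
  by have [UV ?] := loc z Dz; exists UV.
have [|z Dz|N [z [Dz cov]]] := compact_finite_centers (V := fun z => (UV z).2) cD (ex_intro _ x Dx).
- by move=> z /UVP[].
- by have [] := UVP z Dz.
have : \forall y \near x, forall i, (UV (z i)).1 y.
  by apply: filter_forall => i; have [] := UVP _ (Dz i).
apply: filterS => y Uy Dy z' Dz'; have [i Vi] := cov z' Dz'.
have [xU _ _ h] := UVP _ (Dz i).
have h1 := h y z' Dy Dz' (Uy i) Vi; have h2 := h x z' Dx Dz' (nbhs_singleton xU) Vi.
move: h1 h2; rewrite !ler_norml => /andP[? ?] /andP[? ?]; apply/andP; split; lra.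
Qed.

End LocalToFine.

(** * Mixtures of probability measures *)

Section Mixture.
Context {d d' : measure_display} {T : measurableType d} {Y : measurableType d'}
  {R : realType}.
Variables (rho : probability T R) (D : set T) (kap : T -> probability Y R) (w : T -> R).
Hypothesis mD : measurable D.
Hypothesis mkap : forall B, measurable B -> measurable_fun D (fun x => kap x B).
Hypothesis iw : rho.-integrable D (EFin \o w).
Hypothesis w0 : forall x, 0 <= w x.

Definition mixture (B : set Y) : \bar R := (\int[rho]_(x in D) ((w x)%:E * kap x B))%E.

Lemma measurable_mixture B : measurable B ->
  measurable_fun D (fun x => ((w x)%:E * kap x B)%E).
Proof.
by move=> mB; apply: emeasurable_funM; [exact: measurable_int iw|exact: mkap].
Qed.

Lemma mixture_ge0 B : (0 <= mixture B)%E.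
Proof. by apply: integral_ge0 => x _; rewrite mule_ge0// lee_fin. Qed.

Lemma mixture0 : mixture set0 = 0%E.
Proof. by rewrite /mixture integral0_eq// => x _; rewrite measure0 mule0. Qed.

Lemma mixture_sigma_additive : semi_sigma_additive mixture.
Proof.
move=> F mF tF mUF.
have -> : mixture (\bigcup_n F n) = (\sum_(n <oo) mixture (F n))%E.
  rewrite /mixture -integral_nneseries//.
  - apply: eq_integral => x _; rewrite nneseriesZl//; congr (_ * _)%E.
    exact/esym/cvg_lim/measure_semi_sigma_additive.
  - by move=> n; exact: measurable_mixture.
  - by move=> n x _; rewrite mule_ge0// lee_fin.
by apply: is_cvg_nneseries => n _ _; exact: mixture_ge0.
Qed.

Lemma mixture_fin_num B : measurable B -> mixture B \is a fin_num.
Proof.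
move=> mB; rewrite ge0_fin_numE ?mixture_ge0//.
have /integrableP[_] := iw; apply: le_lt_trans; apply: ge0_le_integral => //.
- by move=> x _; rewrite mule_ge0// lee_fin.
- exact: measurable_mixture.
- by apply: measurableT_comp => //; exact: measurable_int iw.
- move=> x _; rewrite /= ger0_norm// -[leRHS]mule1.
  by apply: lee_wpmul2l; rewrite ?lee_fin// probability_le1.
Qed.

Lemma mixture_measure : exists m : {finite_measure set Y -> \bar R},
  forall B, measurable B -> m B = mixture B.
Proof.
pose mm := isMeasure.Build _ _ _ mixture mixture0 mixture_ge0 mixture_sigma_additive.
pose m1 : {measure set Y -> \bar R} := HB.pack mixture mm.
pose mf := Measure_isFinite.Build _ _ _ m1 mixture_fin_num.
pose m2 : {finite_measure set Y -> \bar R} := HB.pack mixture mm mf.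
by exists m2.
Qed.

Lemma fine_mixture B : measurable B ->
  fine (mixture B) = \int[rho]_(x in D) (w x * fine (kap x B)).
Proof.
move=> mB; congr fine; apply: eq_integral => x _.
by rewrite EFinM fineK// fin_num_measure.
Qed.

Lemma integrable_mixture B : measurable B ->
  rho.-integrable D (EFin \o (fun x => w x * fine (kap x B))).
Proof.
move=> mB; apply: (@integrable_mul_bounded _ _ _ _ _ mD 1) => //.
  by apply: measurableT_comp => //; exact: mkap.
move=> x _; rewrite ger0_norm ?fine_ge0//.
by rewrite -lee_fin fineK ?probability_le1// fin_num_measure.
Qed.

Lemma cell_mass_cst1 (m : {measure set Y -> \bar R}) (S : set Y) N (pi : Y -> 'I_N.+1) i :
  measurable S -> (forall i, measurable (S `&` pi @^-1` [set i])) ->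
  cell_mass S pi m (cst 1) i = fine (m (cell S pi i)).
Proof.
move=> mS mpi; rewrite /cell_mass; under eq_Rintegral do rewrite /= mul1r.
rewrite /Rintegral integral_indic//; last exact: mpi.
by congr (fine (m _)); rewrite setIidl// => y [].
Qed.

Lemma riemann_measure (m : {finite_measure set Y -> \bar R}) (S : set Y) (f : Y -> R) (e : R)
    N (y : 'I_N.+1 -> Y) (pi : Y -> 'I_N.+1) :
  measurable S -> uosc S f -> (forall i, measurable (S `&` pi @^-1` [set i])) ->
  (forall z, S z -> `|f (y (pi z)) - f z| <= e) ->
  `|\sum_i fine (m (cell S pi i)) * f (y i) - \int[m]_(z in S) f z| <= e * fine (m S).
Proof.
move=> mS fu mpi fe; have [M fM] := uosc_bounded fu.
have i1 : m.-integrable S (EFin \o cst (1 : R)) by exact: finite_measure_integrable_cst.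
have := @riemann_sum _ _ _ S mS _ pi mpi m (cst 1) i1 f y e.
under eq_bigr do rewrite cell_mass_cst1//.
under [X in _ - X]eq_Rintegral do rewrite /= mul1r.
under [X in e * X]eq_Rintegral do rewrite /= normr1.
rewrite Rintegral_cst// mul1r; apply=> //.
apply: (@integrable_mul_bounded _ _ _ _ _ mS M) => //.
exact: uosc_measurable.
Qed.

Lemma Rintegral_prob_bounded (p : probability Y R) (S : set Y) (f : Y -> R) (M : R) :
  measurable S -> uosc S f -> 0 <= M -> (forall z, S z -> `|f z| <= M) ->
  `|\int[p]_(z in S) f z| <= M.
Proof.
move=> mS fu M0 fM.
have ic : p.-integrable S (EFin \o cst M) by exact: finite_measure_integrable_cst.
have p1 : fine (p S) <= 1 by rewrite -lee_fin fineK ?probability_le1// fin_num_measure.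
apply: (@le_trans _ _ (\int[p]_(z in S) M)); last by rewrite Rintegral_cst// ler_piMr.
apply: normr_Rintegral_le => //; apply: (integrable_le mS _ ic) => //.
exact: uosc_measurable.
Qed.

(** Both sides are compared with the same Riemann sum over a partition of [S]: the weights
    [m (cell i)] are by definition integrals of [kap x (cell i)], and the two errors are [e * m S]
    and [e * \int w]. *)
Lemma integral_mixture (m : {finite_measure set Y -> \bar R}) (S : set Y) (f : Y -> R) :
  (forall B, measurable B -> m B = mixture B) -> measurable S -> uosc S f ->
  measurable_fun D (fun x => \int[kap x]_(y in S) f y) ->
  \int[m]_(y in S) f y = \int[rho]_(x in D) (w x * \int[kap x]_(y in S) f y).
Proof.
move=> mE mS fu mJ; have [M0 fM0] := uosc_bounded fu.
pose M := Num.max 0 M0.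
have M_ge0 : 0 <= M by rewrite le_max lexx.
have fM z : S z -> `|f z| <= M by move=> /fM0 h; rewrite le_max h orbT.
pose J x := \int[kap x]_(y in S) f y; pose W := \int[rho]_(x in D) w x.
have W0 : 0 <= W by apply: Rintegral_ge0 => x _.
have iJ : rho.-integrable D (EFin \o (fun x => w x * J x)).
  apply: (@integrable_mul_bounded _ _ _ _ _ mD M) => // x _.
  exact: Rintegral_prob_bounded.
apply/eqP; rewrite -subr_eq0 -normr_le0.
apply: (@ler0_of_forall _ (fine (m S) + W)); first by rewrite addr_ge0// fine_ge0.
move=> e e0; have [N [y [pi [Sy mpi ypi]]]] := fu e e0.
have h1 := riemann_measure m mS fu mpi ypi.
set s := \sum_i _ in h1.
pose Js x := \sum_i fine (kap x (cell S pi i)) * f (y i).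
have Jsi : rho.-integrable D (EFin \o (fun x => w x * Js x)).
  have := @integrable_bigsum _ _ _ rho D mD _ (index_enum _)
    (fun i x => f (y i) * (w x * fine (kap x (cell S pi i)))).
  move=> /(_ (fun i => integrable_scale mD (f (y i)) (integrable_mixture (mpi i)))).
  apply: eq_integrable => // x _ /=; congr EFin; rewrite /Js mulr_sumr.
  by apply: eq_bigr => i _; rewrite mulrC mulrA.
have sE : s = \int[rho]_(x in D) (w x * Js x).
  have -> : s = \sum_i \int[rho]_(x in D) (f (y i) * (w x * fine (kap x (cell S pi i)))).
    apply: eq_bigr => i _; rewrite RintegralZl ?integrable_mixture//; [|exact: mpi..].
    by rewrite mulrC mE ?fine_mixture//; exact: mpi.
  rewrite -(Rintegral_bigsum mD _ (fun i => integrable_scale mD (f (y i)) (integrable_mixture (mpi i)))).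
  apply: eq_Rintegral => x _; rewrite /Js mulr_sumr.
  by apply: eq_bigr => i _; rewrite mulrC mulrA.
have h2 : `|s - \int[rho]_(x in D) (w x * J x)| <= e * W.
  rewrite sE -RintegralB// /W -RintegralZl//.
  apply: normr_Rintegral_le => //; [exact: integrable_sub|exact: integrable_scale|].
  move=> x Dx; rewrite -mulrBr normrM (ger0_norm (w0 x)) mulrC ler_wpM2r//.
  apply: (le_trans (riemann_measure (kap x) mS fu mpi ypi)).
  rewrite ler_piMr ?(ltW e0)//.
  by rewrite -lee_fin fineK ?probability_le1// fin_num_measure.
move: h1 h2; rewrite -/(J _); move: (\int[rho]_(x in D) _) (\int[m]_(y in S) _) (fine (m S)) => a b c.
rewrite !ler_norml => /andP[? ?] /andP[? ?]; apply/andP; split; lra.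
Qed.

End Mixture.

(** * Continuous approximation of indicators of open sets *)

Section DistanceFunction.
Context {R : realType} {n : nat}.
Variable O : set 'rV[R]_n.
Hypothesis Oc0 : ~` O !=set0.

Definition dist_compl (y : 'rV[R]_n) : R := inf [set `|y - z| | z in ~` O].

Lemma has_inf_dist y : has_inf [set `|y - z| | z in ~` O].
Proof.
by have [z Oz] := Oc0; split; [exists `|y - z|, z|exists 0 => _ [z' _ <-]].
Qed.

Lemma dist_compl_le y z : ~ O z -> dist_compl y <= `|y - z|.
Proof. by move=> Oz; apply: ge_inf; [exact: (has_inf_dist y).2|exists z]. Qed.

Lemma dist_compl_ge y c : (forall z, ~ O z -> c <= `|y - z|) -> c <= dist_compl y.
Proof.
by move=> h; apply: lb_le_inf; [exact: (has_inf_dist y).1|move=> _ [z Oz <-]; exact: h].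
Qed.

Lemma dist_compl_lip y y' : dist_compl y <= `|y - y'| + dist_compl y'.
Proof.
rewrite -lerBlDl; apply: dist_compl_ge => z Oz; rewrite lerBlDl.
by rewrite (le_trans (dist_compl_le y Oz))// -[y - z](subrKA y') ler_normD.
Qed.

Lemma dist_compl_out y : ~ O y -> dist_compl y = 0.
Proof.
move=> Oy; apply/eqP; rewrite eq_le; apply/andP; split.
  by rewrite (le_trans (dist_compl_le y Oy))// subrr normr0.
by apply: dist_compl_ge.
Qed.

Lemma dist_compl_in y : open O -> O y -> 0 < dist_compl y.
Proof.
move=> oO Oy; have /nbhs_ballP[r r0 rO] : nbhs y O by exact: open_nbhs_nbhs.
apply: (lt_le_trans r0); apply: dist_compl_ge => z Oz.
rewrite leNgt; apply/negP => yz; apply/Oz/rO.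
by rewrite -ball_normE.
Qed.

Definition ramp (i : nat) (y : 'rV[R]_n) : R := Num.min 1 (i%:R * dist_compl y).

Lemma ramp_ge0 i y : 0 <= ramp i y.
Proof. by rewrite le_min ler01 mulr_ge0//; apply: dist_compl_ge. Qed.

Lemma ramp_le1 i y : ramp i y <= 1.
Proof. by rewrite ge_min lexx. Qed.

Lemma ramp_continuous i : continuous (ramp i).
Proof.
have lip y y' : ramp i y <= ramp i y' + i%:R * `|y - y'|.
  rewrite /ramp ge_min.
  have [h|h] := leP 1 (i%:R * dist_compl y').
    by rewrite lerDl mulr_ge0.
  by rewrite -mulrDr addrC ler_wpM2l ?orbT// dist_compl_lip.
move=> y; apply/(@cvgrPdist_le _ _ _ (nbhs y) (nbhs_filter y)) => e e0.
(* The ramp is [i]-Lipschitz; [i.+1] is used in the radius since [i] may be 0. *)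
have e1 : 0 < e / i.+1%:R by rewrite divr_gt0.
apply/nbhs_ballP; exists (e / i.+1%:R) => //= y'; rewrite -ball_normE/= => /ltW yy'.
have {}yy' : i%:R * `|y - y'| <= e.
  apply: (@le_trans _ _ (i.+1%:R * `|y - y'|)); first by rewrite ler_wpM2r// ler_nat.
  by rewrite mulrC -ler_pdivlMr.
have := lip y y'; have := lip y' y; rewrite (distrC y' y) ler_norml => ? ?.
by apply/andP; split; lra.
Qed.

Lemma ramp_cvg y : open O -> ramp i y @[i --> \oo] --> (\1_O y : R).
Proof.
move=> oO; have [Oy|Oy] := pselect (O y); last first.
  rewrite indicE memNset//; under eq_fun do rewrite /ramp dist_compl_out// mulr0 min_r ?ler01//.
  exact: cvg_cst.
rewrite indicE mem_set//; apply: cvg_near_cst.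
have dy := dist_compl_in oO Oy.
near=> i; rewrite /ramp min_l// -ler_pdivrMr// mul1r.
near: i; exact: nbhs_infty_ger.
Unshelve. all: end_near. Qed.

End DistanceFunction.

(** Open sets form a pi-system generating the Borel sets. For an open [O], the ramps converge to its
    indicator, so dominated convergence makes [kap x O] a limit of measurable functions of [x];
    complements and disjoint unions follow. *)
Lemma measurable_kernel_of_continuous {d} {T : measurableType d} {R : realType} n
    (D : set T) (S : set 'rV[R]_n) (kap : T -> probability 'rV[R]_n R) :
  measurable D -> compact S -> S !=set0 -> (forall x, D x -> kap x (~` S) = 0%E) ->
  (forall f : 'rV[R]_n -> R, continuous f -> (exists M, forall y, `|f y| <= M) ->
     measurable_fun D (fun x => \int[kap x]_(y in S) f y)) ->
  forall B, measurable B -> measurable_fun D (fun x => kap x B).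
Proof.
move=> mD cS S0 kS kf; have mS := compact_measurable_rV cS.
apply: (@dynkin_induction _ 'rV[R]_n (@open 'rV[R]_n)
  [set B | measurable_fun D (fun x => kap x B)]) => //.
- by move=> U V; exact: openI.
- by rewrite /=; under eq_fun do rewrite probability_setT; exact: measurable_cst.
- move=> O oO /=.
  (* The ramps use the distance to the complement, so the whole space is treated apart. *)
  have [Oc0|Oc0] := pselect (~` O !=set0); last first.
    have -> : O = setT.
      by apply/seteqP; split=> // y _; apply: contrapT => Oy; apply: Oc0; exists y.
    by under eq_fun do rewrite probability_setT; exact: measurable_cst.
  have mO := open_measurable_rV oO.
  have mb i : measurable_fun S (ramp O i).
    apply: uosc_measurable => e e0; apply: fine_partition_rV => // x Sx.
    by apply: (within_continuous_near (D := S)) => //; exact/continuous_subspaceT/ramp_continuous.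
  have b1 i y : `|ramp O i y| <= 1 by rewrite ger0_norm ?ramp_ge0// ramp_le1.
  apply: (@emeasurable_fun_cvg _ _ _ D (fun i x => (\int[kap x]_(y in S) ramp O i y)%:E)).
    move=> i; apply/measurable_EFinP/kf; first exact: ramp_continuous.
    by exists 1 => y; exact: b1.
  move=> x Dx.
  have ib i : (kap x).-integrable S (EFin \o ramp O i).
    apply: (@integrable_bounded _ _ _ _ _ mS 1) => //.
    by rewrite (le_lt_trans (probability_le1 _ mS))// ltry.
  (* The hypothesis concerns integrals over [S]; the part of [O] outside [S] is null by [kS]. *)
  have -> : kap x O = (\int[kap x]_(y in S) (\1_O y)%:E)%E.
    rewrite integral_indic// [LHS](measureDI (kap x) mO mS).
    rewrite [X in (X + _)%E](_ : _ = 0%E) ?add0e//.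
    apply/eqP; rewrite eq_le measure_ge0 andbT -(kS x Dx).
    by apply: le_measure; rewrite ?inE; [exact: measurableD|exact: measurableC|move=> y []].
  have -> : (fun i => (\int[kap x]_(y in S) ramp O i y)%:E) =
      (fun i => \int[kap x]_(y in S) (ramp O i y)%:E)%E.
    by apply/funext => i; rewrite /Rintegral fineK//; exact: integrable_fin_num (ib i).
  have [] := @dominated_convergence _ _ _ (kap x) S mS (fun i y => (ramp O i y)%:E)
    (fun y => (\1_O y)%:E) (cst 1%E).
  - by move=> i; exact/measurable_EFinP.
  - exact/measurable_EFinP/measurable_indic.
  - by apply: aeW => y _; apply: cvg_EFin; [exact: nearW|exact: ramp_cvg].
  - exact: finite_measure_integrable_cst.
  - by apply: aeW => y i _; rewrite /= lee_fin b1.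
  - by [].
- move=> B mB /= kB.
  have -> : (fun x => kap x (~` B)) = (fun x => 1 - kap x B)%E.
    by apply/funext => x; rewrite probability_setC.
  by apply: emeasurable_funB => //; exact: measurable_cst.
- move=> F mF tF /= kF.
  apply: (@emeasurable_fun_cvg _ _ _ D (fun i x => (\sum_(0 <= j < i) kap x (F j))%E)).
    by move=> i; apply: emeasurable_sum => j; exact: kF.
  by move=> x _; apply: measure_semi_sigma_additive => //; exact: bigcup_measurable.
Qed.

(** * Bellman images and the equivalence *)

Section DominatedAlgebra.
Context {R : realType} {X : Type}.
Variables (D : set X) (k : X -> X -> R).
Hypothesis kpd : pos_def_kernel D k.

Lemma dominated_ext f g (c : R) : (forall x, D x -> f x = g x) ->
  dominated D k f c -> dominated D k g c.
Proof.
move=> fg fc v Dv; have := fc v Dv; congr (_ ^+ 2 <= _).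
by apply: (eq_big_comb Dv) => p Dp; rewrite fg.
Qed.

(** The unsquared form, in which bounds add by the triangle inequality. *)
Lemma dominatedP f (c : R) : 0 <= c -> dominated D k f c <->
  forall v, comb_pts D v -> `|comb_apply f v| <= c * Num.sqrt (comb_norm2 k v).
Proof.
move=> c0; split=> h v Dv; have N0 := comb_norm2_ge0 kpd Dv; have := h v Dv.
  rewrite -(ler_sqrt _ (mulr_ge0 (sqr_ge0 c) N0)) sqrtr_sqr sqrtrM ?sqr_ge0//.
  by rewrite sqrtr_sqr (ger0_norm c0).
rewrite -(ler_pXn2r (ltn0Sn 1)) ?nnegrE ?mulr_ge0 ?sqrtr_ge0//.
by rewrite exprMn sqr_sqrtr// real_normK ?num_real.
Qed.

Lemma dominated_le f (c c' : R) : 0 <= c -> c <= c' ->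
  dominated D k f c -> dominated D k f c'.
Proof.
move=> c0 cc' fc v Dv; apply: (le_trans (fc v Dv)).
rewrite ler_wpM2r ?(comb_norm2_ge0 kpd Dv)// ler_pXn2r ?nnegrE//.
exact: le_trans cc'.
Qed.

Lemma dominated_add f g (c c' : R) : 0 <= c -> 0 <= c' ->
  dominated D k f c -> dominated D k g c' ->
  dominated D k (fun x => f x + g x) (c + c').
Proof.
move=> c0 c0' /(dominatedP _ c0) fc /(dominatedP _ c0') gc.
apply/dominatedP => [|v Dv]; first exact: addr_ge0.
have -> : comb_apply (fun x => f x + g x) v = comb_apply f v + comb_apply g v.
  by rewrite /comb_apply -big_split/=; apply: eq_bigr => p _; rewrite mulrDr.
by rewrite (le_trans (ler_normD _ _))// mulrDl lerD ?fc ?gc.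
Qed.

Lemma dominated_scale t f (c : R) : dominated D k f c ->
  dominated D k (fun x => t * f x) (`|t| * c).
Proof.
move=> fc v Dv.
have -> : comb_apply (fun x => t * f x) v = t * comb_apply f v.
  by rewrite /comb_apply mulr_sumr; apply: eq_bigr => p _; rewrite mulrCA.
rewrite !exprMn real_normK ?num_real// -[leRHS]mulrA.
exact: (ler_wpM2l (sqr_ge0 t) (fc v Dv)).
Qed.

Lemma dominated0 f (c : R) : (forall x, D x -> f x = 0) -> dominated D k f c.
Proof.
move=> f0; apply: (@dominated_ext (fun=> 0)) => [x Dx|v Dv]; first by rewrite f0.
rewrite {1}/comb_apply big1 => [|p _]; last by rewrite mulr0.
by rewrite expr0n/= mulr_ge0 ?sqr_ge0// (comb_norm2_ge0 kpd Dv).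
Qed.

End DominatedAlgebra.

Section SupNorm.
Context {R : realType} {T : topologicalType}.
Variable S : set T.
Hypothesis S0 : S !=set0.

Lemma supnorm_ub (f : T -> R) x : bcont S f -> S x -> `|f x| <= supnorm S f.
Proof.
move=> [_ [M fM]] Sx; apply: sup_upper_bound; last by exists x.
by split; [exists `|f x|, x|exists M => _ [y Sy <-]; exact: fM].
Qed.

Lemma supnorm_le (f : T -> R) (c : R) : (forall x, S x -> `|f x| <= c) -> supnorm S f <= c.
Proof.
move=> fc; apply: ge_sup; last by move=> _ [y Sy <-]; exact: fc.
by have [x Sx] := S0; exists `|f x|, x.
Qed.

Lemma supnorm_ge0 (f : T -> R) : bcont S f -> 0 <= supnorm S f.
Proof.
by move=> fb; have [x Sx] := S0; exact: le_trans (normr_ge0 _) (supnorm_ub fb Sx).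
Qed.

Lemma bcont_scale (t : R) (f : T -> R) : bcont S f -> bcont S (fun x => t * f x).
Proof.
move=> [cf [M fM]]; split.
  by move=> x; apply: cvgMr; exact: cf.
by exists (`|t| * M) => x Sx; rewrite normrM ler_wpM2l// fM.
Qed.

Lemma bcont_cst (c : R) : bcont S (fun=> c).
Proof. by split; [move=> x; exact: cvg_cst|exists `|c|]. Qed.

End SupNorm.

(** * The compact state-action space *)

Section Core.
Context {R : realType} {dS dA : nat}.
Variables (S : set 'rV[R]_dS) (A : set 'rV[R]_dA).
Variable k : ('rV[R]_dS * 'rV[R]_dA)%type -> ('rV[R]_dS * 'rV[R]_dA)%type -> R.
Variable rho : probability ('rV[R]_dS * 'rV[R]_dA)%type R.
Variables (lambda : nat -> R) (psi : nat -> ('rV[R]_dS * 'rV[R]_dA)%type -> R).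
Local Notation D := (S `*` A).
Local Notation L2 := (L2fun rho D).
Local Notation ip := (L2inner rho D).
Local Notation K := (intop rho D k).
Hypothesis cD : compact D.
Hypothesis kpd : pos_def_kernel D k.
Hypothesis kcont : {within D `*` D, continuous (fun q => k q.1 q.2)}.
Hypothesis rhoD : rho (~` D) = 0%E.
Hypothesis supp : forall U, open U -> U `&` D !=set0 -> (0 < rho (U `&` D))%E.

Lemma domain_nonempty : D !=set0.
Proof.
apply: contrapT => D0; have DT : ~` D = setT.
  by apply/seteqP; split=> // x _ Dx; apply: D0; exists x.
by move: rhoD; rewrite DT probability_setT => /eqP; rewrite onee_eq0.
Qed.

Lemma state_nonempty : S !=set0.
Proof. by have [x [Sx _]] := domain_nonempty; exists x.1. Qed.

Lemma compact_state : compact S.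
Proof.
have [[s0 a0] [Ss0 Aa0]] := domain_nonempty.
have -> : S = fst @` D.
  by apply/seteqP; split=> [s Ss|_ [x [Sx _] <-]//]; exists (s, a0).
apply: continuous_compact => //; apply: continuous_subspaceT => x; exact: cvg_fst.
Qed.

Lemma compact_action : compact A.
Proof.
have [[s0 a0] [Ss0 Aa0]] := domain_nonempty.
have -> : A = snd @` D.
  by apply/seteqP; split=> [a Aa|_ [x [_ Ax] <-]//]; exists (s0, a).
apply: continuous_compact => //; apply: continuous_subspaceT => x; exact: cvg_snd.
Qed.

Lemma measurable_domain : measurable D.
Proof.
by apply: measurableX; apply: compact_measurable_rV;
  [exact: compact_state|exact: compact_action].
Qed.

Let mD := measurable_domain.

Lemma kernel_fine (e : R) : 0 < e -> fine_partition D (kclose D k e).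
Proof.
move=> e0; apply: fine_partition_prod => //; first exact: domain_nonempty.
by move=> x Dx; exact: kclose_near.
Qed.

Lemma kuosc_near (g : ('rV[R]_dS * 'rV[R]_dA)%type -> R) x (e : R) :
  {within D, continuous g} -> D x -> 0 < e ->
  \forall y \near x, D y -> kclose D k e x y /\ `|g x - g y| <= e.
Proof.
move=> cg Dx e0; have h1 := kclose_near cD kcont Dx e0.
have h2 := within_continuous_near cg Dx e0.
by apply: filterS2 h1 h2 => y h1 h2 Dy; split; [exact: h1|exact: h2].
Qed.

Lemma within_continuous_kuosc (g : ('rV[R]_dS * 'rV[R]_dA)%type -> R) :
  {within D, continuous g} -> kuosc D k g.
Proof.
move=> cg e e0; apply: fine_partition_prod => //; first exact: domain_nonempty.
by move=> x Dx; exact: kuosc_near.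
Qed.

Lemma within_continuous_uosc (g : ('rV[R]_dS * 'rV[R]_dA)%type -> R) :
  {within D, continuous g} -> uosc D g.
Proof.
move=> cg e e0; apply: fine_partition_prod => //; first exact: domain_nonempty.
by move=> x Dx; exact: within_continuous_near.
Qed.

Lemma within_continuous_L2 (g : ('rV[R]_dS * 'rV[R]_dA)%type -> R) :
  {within D, continuous g} -> L2 g.
Proof. by move=> cg; apply: L2_uosc => //; exact: within_continuous_uosc. Qed.

Lemma bcont_uosc (f : 'rV[R]_dS -> R) : bcont S f -> uosc S f.
Proof.
move=> [cf _] e e0; apply: fine_partition_rV; [exact: compact_state|exact: state_nonempty|].
by move=> x Sx; exact: within_continuous_near.
Qed.

(** Point masses are averaged over [ball x r] cut down to [D], with [r] small for [k] and [g] at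
    once; full support makes these sets non-null. *)
Lemma L2_dominated_continuous (g : ('rV[R]_dS * 'rV[R]_dA)%type -> R) (B : R) :
  {within D, continuous g} ->
  (forall phi, L2 phi -> ip phi g ^+ 2 <= B ^+ 2 * ip phi (K phi)) ->
  dominated D k g B.
Proof.
move=> cg; apply: (L2_dominated mD kpd kernel_fine); first exact: within_continuous_L2.
move=> x e Dx e0; have /nbhs_ballP[r r0 h] := kuosc_near cg Dx e0.
exists (ball x r `&` D); split.
- by apply: measurableI => //; exact: ball_prod_measurable.
- by move=> y [].
- by apply: supp; [exact: ball_open|exists x; split=> //; exact: ballxx].
- by move=> y [xy Dy]; exact: h.
Qed.

Lemma dominated_continuous_L2 (g : ('rV[R]_dS * 'rV[R]_dA)%type -> R) (B : R) phi :
  {within D, continuous g} -> dominated D k g B -> L2 phi ->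
  ip phi g ^+ 2 <= B ^+ 2 * ip phi (K phi).
Proof.
move=> cg gB Lphi.
exact: (dominated_L2 mD kpd kernel_fine gB (within_continuous_kuosc cg) Lphi).
Qed.

(* The coefficients [\int f dP psi_i] come from the signed measure
   [B |-> \int psi_i(x) P(x)(B) drho(x)], split according to the sign of [psi_i]. *)
Lemma coefficient_measures (kap : 'rV[R]_dS * 'rV[R]_dA -> probability 'rV[R]_dS R)
    (phi : ('rV[R]_dS * 'rV[R]_dA)%type -> R) :
  (forall x, D x -> kap x (~` S) = 0%E) ->
  (forall f, bcont S f -> {within D, continuous (fun x => \int[kap x]_(s in S) f s)}) ->
  L2 phi ->
  exists mp mn : {finite_measure set 'rV[R]_dS -> \bar R}, forall f, bcont S f ->
    \int[mp]_(s in S) f s - \int[mn]_(s in S) f s =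
    ip (fun x => \int[kap x]_(s in S) f s) phi.
Proof.
move=> kapS feller Lphi.
have mkap : forall B, measurable B -> measurable_fun D (fun x => kap x B).
  apply: (measurable_kernel_of_continuous mD compact_state state_nonempty kapS).
  move=> f cf [M fM]; apply: (within_continuous_L2 (feller f _)).1.
  by split; [exact: continuous_subspaceT|exists M].
have iphi := L2_integrable mD Lphi.
(* The positive and negative parts of [phi]. *)
pose wp x := 2^-1 * (`|phi x| + phi x); pose wn x := 2^-1 * (`|phi x| - phi x).
have iwp : rho.-integrable D (EFin \o wp).
  by apply: integrable_scale => //; apply: integrable_add => //; exact: integrable_norm.
have iwn : rho.-integrable D (EFin \o wn).
  by apply: integrable_scale => //; apply: integrable_sub => //; exact: integrable_norm.
have wp0 x : 0 <= wp x.
  by rewrite mulr_ge0// -lerBlDr sub0r -normrN ler_norm.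
have wn0 x : 0 <= wn x by rewrite mulr_ge0// subr_ge0 ler_norm.
have [mp mpE] := mixture_measure mD mkap iwp wp0.
have [mn mnE] := mixture_measure mD mkap iwn wn0.
have mS := compact_measurable_rV compact_state.
exists mp, mn => f fb; have fu := bcont_uosc fb; have Lg := within_continuous_L2 (feller f fb).
have [M gM] := uosc_bounded (within_continuous_uosc (feller f fb)).
rewrite (integral_mixture mD mkap iwp wp0 mpE mS fu Lg.1).
rewrite (integral_mixture mD mkap iwn wn0 mnE mS fu Lg.1).
rewrite -RintegralB//; [|exact: (@integrable_mul_bounded _ _ _ _ _ mD M _ _ _ Lg.1)..].
apply: eq_Rintegral => x _; rewrite /wp /wn -mulrBl; by field.
Qed.

Hypothesis lambda_gt0 : forall i, 0 < lambda i.
Hypothesis lambdaS : forall i, lambda i.+1 <= lambda i.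
Hypothesis Lpsi : forall i, L2 (psi i).
Hypothesis psi_ortho : forall i j, ip (psi i) (psi j) = (i == j)%:R.
Hypothesis psi_eigen : forall i, {ae rho, forall x, D x -> K (psi i) x = lambda i * psi i x}.
Hypothesis psi_complete : forall (l : R) (g : ('rV[R]_dS * 'rV[R]_dA)%type -> R),
  0 < l -> L2 g -> {ae rho, forall x, D x -> K g x = l * g x} ->
  L2dist2 rho D g (fun x => \sum_(i < n) ip g (psi i) * psi i x) @[n --> \oo] --> 0.

Lemma expansion_dominated (g : ('rV[R]_dS * 'rV[R]_dA)%type -> R) (c : nat -> R) (B : R) :
  {within D, continuous g} ->
  L2dist2 rho D g (fun x => \sum_(i < n) c i * psi i x) @[n --> \oo] --> 0 ->
  (\sum_(0 <= i <oo) ((c i ^+ 2 / lambda i)%:E) <= (B ^+ 2)%:E)%E ->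
  dominated D k g B.
Proof.
move=> cg gc cB; apply: L2_dominated_continuous => //.
apply: (series_dominates mD kpd kernel_fine lambda_gt0 Lpsi psi_ortho psi_eigen _ gc).
  exact: within_continuous_L2.
move=> n; rewrite -lee_fin; apply: le_trans cB.
rewrite -sumEFin -(big_mkord xpredT (fun i => (c i ^+ 2 / lambda i)%:E)).
by apply: nneseries_lim_ge => i _ _; rewrite lee_fin divr_ge0 ?sqr_ge0// ltW.
Qed.

Lemma dominated_expansion (g : ('rV[R]_dS * 'rV[R]_dA)%type -> R) (B : R) :
  {within D, continuous g} -> dominated D k g B ->
  L2dist2 rho D g (fun x => \sum_(i < n) ip g (psi i) * psi i x) @[n --> \oo] --> 0 /\
  (\sum_(0 <= i <oo) ((ip g (psi i) ^+ 2 / lambda i)%:E) <= (B ^+ 2)%:E)%E.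
Proof.
move=> cg gB; have Lg := within_continuous_L2 cg.
have gphi phi : L2 phi -> ip phi g ^+ 2 <= B ^+ 2 * ip phi (K phi).
  exact: dominated_continuous_L2.
split.
  have := residue_cvg0 mD kpd kernel_fine lambda_gt0 lambdaS Lpsi psi_ortho psi_eigen
    psi_complete Lg gphi.
  by apply: cvg_trans; apply: near_eq_cvg; apply: nearW => n; rewrite -L2dist2E.
apply: lime_le.
  by apply: is_cvg_nneseries => i _ _; rewrite lee_fin divr_ge0 ?sqr_ge0// ltW.
apply: nearW => n; rewrite big_mkord sumEFin lee_fin.
exact: (coef_sum_le mD kpd kernel_fine lambda_gt0 Lpsi psi_ortho psi_eigen n Lg gphi).
Qed.

End Core.

Theorem theorem3 (R : realType) (dS dA H : nat)
  (S : set 'rV[R]_dS) (A : set 'rV[R]_dA)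
  (P : 'I_H -> 'rV[R]_dS -> 'rV[R]_dA -> probability 'rV[R]_dS R)
  (r : 'I_H -> 'rV[R]_dS -> 'rV[R]_dA -> R)
  (mu : probability 'rV[R]_dS R)
  (k : ('rV[R]_dS * 'rV[R]_dA)%type -> ('rV[R]_dS * 'rV[R]_dA)%type -> R)
  (rho : probability ('rV[R]_dS * 'rV[R]_dA)%type R)
  (lambda : nat -> R) (psi : nat -> ('rV[R]_dS * 'rV[R]_dA)%type -> R) :
  (* the MDP *)
  (forall h s a, S s -> A a -> P h s a (~` S) = 0%E) ->
  (forall h, {within S `*` A, continuous (fun p => r h p.1 p.2)}) ->
  (forall h s a, S s -> A a -> 0 <= r h s a <= 1) ->
  mu (~` S) = 0%E ->
  (* compactness and Feller continuity *)
  compact (S `*` A) ->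
  (forall h f, bcont S f ->
     {within S `*` A, continuous
        (fun p => \int[P h p.1 p.2]_(s' in S) f s')}) ->
  (* the kernel *)
  pos_def_kernel (S `*` A) k ->
  {within (S `*` A) `*` (S `*` A), continuous (fun q => k q.1 q.2)} ->
  (* rho: Borel probability on S x A with full support *)
  rho (~` (S `*` A)) = 0%E ->
  (forall U, open U -> U `&` (S `*` A) !=set0 -> (0 < rho (U `&` (S `*` A)))%E) ->
  (* (lambda_i, psi_i): all positive eigenpairs of K_rho, with multiplicity *)
  (forall i, 0 < lambda i) ->
  (forall i, lambda i.+1 <= lambda i) ->
  (forall i, L2fun rho (S `*` A) (psi i)) ->
  (forall i j, L2inner rho (S `*` A) (psi i) (psi j) = (i == j)%:R) ->
  (forall i, {ae rho, forall x, (S `*` A) x ->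
       intop rho (S `*` A) k (psi i) x = lambda i * psi i x}) ->
  (forall (l : R) (g : ('rV[R]_dS * 'rV[R]_dA)%type -> R),
      0 < l -> L2fun rho (S `*` A) g ->
      {ae rho, forall x, (S `*` A) x -> intop rho (S `*` A) k g x = l * g x} ->
      (fun n => L2dist2 rho (S `*` A) g
         (fun x => \sum_(i < n) L2inner rho (S `*` A) g (psi i) * psi i x))
        @ \oo --> 0) ->
  (* the equivalence (1) <-> (2) *)
  ((forall h : 'I_H,
      in_rkhs (S `*` A) k (fun p => r h p.1 p.2) /\
      exists (mup mun : nat -> {finite_measure set 'rV[R]_dS -> \bar R}) (C : R),
        0 < C /\
        forall f, bcont S f ->
          let c := fun i => \int[mup i]_(s' in S) f s' - \int[mun i]_(s' in S) f s' in
          (fun n => L2dist2 rho (S `*` A)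
              (fun p => \int[P h p.1 p.2]_(s' in S) f s')
              (fun p => \sum_(i < n) c i * psi i p)) @ \oo --> 0 /\
          (\sum_(0 <= i <oo) ((c i ^+ 2 / lambda i)%:E) <=
             (C * supnorm S f ^+ 2)%:E)%E)
   <->
   (exists C' : R, 0 < C' /\
      forall (h : 'I_H) f, bcont S f ->
        rkhs_le (S `*` A) k
          (fun p => r h p.1 p.2 + \int[P h p.1 p.2]_(s' in S) f s')
          (C' * (supnorm S f + 1)))).
Proof.
move=> PS rcont r01 muS cD feller kpd kcont rhoD supp lambda_gt0 lambdaS Lpsi
  psi_ortho psi_eigen psi_complete.
have S0 := state_nonempty rhoD.
split.
- move=> h1.
  have /choice[cr crP] h : exists c : R, rkhs_le (S `*` A) k (fun p => r h p.1 p.2) c.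
    by have [[c ?] _] := h1 h; exists c.
  have /choice[C CP] h : exists C : R, 0 < C /\ forall f, bcont S f ->
      dominated (S `*` A) k (fun p => \int[P h p.1 p.2]_(s' in S) f s')
        (Num.sqrt C * supnorm S f).
    have [_ [mup [mun [C [C0 CP]]]]] := h1 h; exists C; split=> // f fb.
    have [fL2 fsum] := CP f fb.
    apply: (expansion_dominated cD kpd kcont rhoD supp lambda_gt0 Lpsi psi_ortho psi_eigen _ fL2).
      exact: feller.
    by rewrite exprMn sqr_sqrtr; [exact: fsum|exact: ltW].
  have cr0 h : 0 <= cr h by case: (rkhs_le_dominated kpd (crP h)).
  (* (2) asks for one constant for all [h], and the horizon is finite. The leading 1 keeps it
     positive when [H = 0]; the root appears because (1) bounds a squared norm. *)
  exists (1 + \sum_h (cr h + Num.sqrt (C h))); split.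
    by rewrite ltr_pwDl// sumr_ge0// => h _; rewrite addr_ge0 ?sqrtr_ge0.
  move=> h f fb; have n0 := supnorm_ge0 S0 fb.
  have hh : cr h + Num.sqrt (C h) <= 1 + \sum_h (cr h + Num.sqrt (C h)).
    rewrite (bigD1 h)//= addrCA lerDl addr_ge0// sumr_ge0// => i _.
    by rewrite addr_ge0 ?sqrtr_ge0.
  apply: dominated_rkhs_le => //.
    apply: mulr_ge0; last by rewrite addr_ge0.
    by apply: le_trans hh; rewrite addr_ge0 ?sqrtr_ge0.
  apply: (@dominated_le _ _ _ _ kpd _ (cr h + Num.sqrt (C h) * supnorm S f)).
  + by rewrite addr_ge0// mulr_ge0// sqrtr_ge0.
  + have := ler_wpM2r (addr_ge0 n0 ler01) hh; apply: le_trans.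
    rewrite mulrDl lerD//; first by rewrite ler_peMr// lerDr.
    by rewrite ler_wpM2l ?sqrtr_ge0// lerDl.
  + apply: dominated_add => //; first by rewrite mulr_ge0 ?sqrtr_ge0.
      by case: (rkhs_le_dominated kpd (crP h)).
    exact: (CP h).2.
- move=> [C' [C'0 h2]] h.
  pose g f := fun p : 'rV[R]_dS * 'rV[R]_dA => \int[P h p.1 p.2]_(s' in S) f s'.
  have mS := compact_measurable_rV (compact_state cD rhoD).
  (* The Bellman image of [f = 0] is the reward itself. *)
  have rk : rkhs_le (S `*` A) k (fun p => r h p.1 p.2) C'.
    have := h2 h _ (bcont_cst S 0).
    have -> : supnorm S (fun=> 0 : R) = 0.
      apply/eqP; rewrite eq_le supnorm_ge0 ?andbT//; last exact: bcont_cst.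
      by apply: supnorm_le => // x _; rewrite normr0.
    rewrite add0r mulr1; congr rkhs_le; apply/funext => p.
    by rewrite Rintegral_cst// mul0r addr0.
  have [_ rdom] := rkhs_le_dominated kpd rk.
  have gdom f : bcont S f -> dominated (S `*` A) k (g f) (C' * (supnorm S f + 2)).
    move=> fb; have [c0 hd] := rkhs_le_dominated kpd (h2 h f fb).
    have := dominated_add kpd c0 _ hd (dominated_scale (-1) rdom).
    rewrite normrN normr1 mul1r => /(_ (ltW C'0)).
    have -> : C' * (supnorm S f + 1) + C' = C' * (supnorm S f + 2) by ring.
    by apply: dominated_ext => x Dx; rewrite mulN1r addrC addKr.
  (* [g f] is linear in [f], so the affine bound need only be used at [f / ||f||], where it is at
     most [C' (1 + 2)]. *)
  have gdom3 f : bcont S f -> dominated (S `*` A) k (g f) (3 * C' * supnorm S f).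
    move=> fb; have n0 := supnorm_ge0 S0 fb.
    (* A function of norm 0 cannot be rescaled, but it vanishes on [S], and so does its integral. *)
    have [n00|nn0] := eqVneq (supnorm S f) 0.
      apply: dominated0 => // x [Sx Ax]; rewrite /g.
      under eq_Rintegral.
        move=> s; rewrite inE => Ss.
        have -> : f s = 0 by apply/eqP; rewrite -normr_le0 -n00 supnorm_ub.
        over.
      by rewrite Rintegral_cst// mul0r.
    have np : 0 < supnorm S f by rewrite lt0r nn0.
    set n := supnorm S f in np *.
    have := dominated_scale n (gdom _ (bcont_scale n^-1 fb)).
    rewrite (gtr0_norm np) => hd.
    apply: (@dominated_ext _ _ _ _ (fun x => n * g (fun s => n^-1 * f s) x)).
      move=> x [Sx Ax]; rewrite /g RintegralZl//; first by rewrite mulVKf.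
      have [M fM] := uosc_bounded (bcont_uosc cD rhoD fb).
      apply: (@integrable_bounded _ _ _ _ _ mS M) => //.
        by rewrite (le_lt_trans (probability_le1 _ mS))// ltry.
      exact: uosc_measurable (bcont_uosc cD rhoD fb).
    apply: dominated_le hd => //.
      rewrite !mulr_ge0// ?addr_ge0 ?(ltW C'0)//.
      by apply: supnorm_ge0 => //; exact: bcont_scale.
    have sn1 : supnorm S (fun s => n^-1 * f s) <= 1.
      apply: supnorm_le => // s Ss; rewrite normrM ger0_norm ?invr_ge0//.
      by rewrite mulrC ler_pdivrMr// mul1r supnorm_ub.
    have : n * C' * (supnorm S (fun s => n^-1 * f s) + 2) <= n * C' * 3.
      by rewrite ler_pM2l ?mulr_gt0//; lra.
    lra.
  split; first by exists C'.
  have /choice[mp mpP] i : exists mp : {finite_measure set 'rV[R]_dS -> \bar R},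
      exists mn : {finite_measure set 'rV[R]_dS -> \bar R}, forall f, bcont S f ->
      \int[mp]_(s in S) f s - \int[mn]_(s in S) f s =
      L2inner rho (S `*` A) (g f) (psi i).
    apply: (coefficient_measures cD rhoD
      (kap := fun x => P h x.1 x.2) _ _ (Lpsi i)) => //.
    - by move=> x [Sx Ax]; exact: PS.
    - by move=> f fb; exact: feller.
  have /choice[mn mnP] := mpP.
  exists mp, mn, ((3 * C') ^+ 2); split; first by rewrite exprn_gt0// mulr_gt0.
  move=> f fb c.
  have -> : c = fun i => L2inner rho (S `*` A) (g f) (psi i).
    by apply/funext => i; rewrite /c mnP.
  rewrite -exprMn.
  apply: (dominated_expansion cD kpd kcont rhoD lambda_gt0 lambdaS Lpsi psi_ortho
    psi_eigen psi_complete); first exact: feller.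
  exact: gdom3.
Qed.
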